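(* Let $X$ be a locally finite building of type $\tilde A_2$, with $q+1$ chambers containing each panel, and put $J=\{0,1,\dots,q\}$. Assume that there is a lattice $\Gamma\le\operatorname{Aut}(X)$ acting regularly on one, and hence on all, types of panels. Then there are three Singer groups $S_1,S_2,S_3$ associated to the three types of possible vertex links (on the three projective planes of order $q$ occurring as links of vertices of the three types), and there are three ordered difference sets $d_1,d_2,d_3$ corresponding to these Singer groups satisfying $d_\alpha(0)=1\in S_\alpha$ for $\alpha\in\{1,2,3\}$, such that $\Gamma$ admits the presentation $$\Gamma\cong\bigl\langle S_1,S_2,S_3\ \big|\ \text{all relations in the groups }S_1,S_2,S_3,\ \ d_1(j)d_2(j)d_3(j)=1\ \ \forall j\in J\bigr\rangle .$$
   Context: A Singer group on a projective plane is a group of automorphisms acting regularly (transitively and freely) on points; on a finite plane it also acts regularly on lines. Given a Singer group $S$ on a projective plane of order $q$, a point $p$ and a line $l$, the corresponding difference set is $D=\{d\in S: p\text{ is incident to }d(l)\}$, which has $q+1$ elements, and an ordered difference set is a bijection $d:J\to D$. Buildings of type $\tilde A_2$ are taken to be thick two-dimensional affine buildings; vertex links are projective planes of a common order $q$; chambers are triangles, panels are edges, and the type of a panel is the pair of types (colours) of its vertices. The lattice acts type-preservingly. Regular means transitive and free. Since $\Gamma$ is transitive on the vertices of each type, vertices of the same type have isomorphic links; the groups $S_1,S_2,S_3$ are the stabilisers in $\Gamma$ of the three vertices of a chamber, acting on the corresponding links. Which of the two types of vertices in a link (a projective plane up to duality) are called points is a matter of choice. *)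

(* Defs.v *)
From HB Require Import structures.
From mathcomp Require Import all_boot all_order all_algebra finmap.
From mathcomp Require Import mathcomp_extra boolp classical_sets functions.
From mathcomp Require Import cardinality.

Set Implicit Arguments.
Unset Strict Implicit.
Unset Printing Implicit Defensive.

Import GRing.Theory Num.Theory.

Local Open Scope classical_set_scope.
Local Open Scope card_scope.
Local Open Scope group_scope.

Record gaction (G : groupType) (T : Type) := GAction {
  gact :> G -> T -> T;
  gact1 : forall x, gact 1 x = x;
  gactM : forall g h x, gact (g * h) x = gact g (gact h x)
}.

Definition faithful_action (G : groupType) (T : Type) (a : gaction G T) :=
  forall g, (forall x, a g x = x) -> g = 1.

Definition acts_transitively_on (G : groupType) (T : Type) (a : gaction G T)
    (A : set T) :=
  forall x y, A x -> A y -> exists g, a g x = y.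

Definition acts_freely_on (G : groupType) (T : Type) (a : gaction G T)
    (A : set T) :=
  forall g x, A x -> a g x = x -> g = 1.

Definition acts_regularly_on (G : groupType) (T : Type) (a : gaction G T)
    (A : set T) :=
  acts_transitively_on a A /\ acts_freely_on a A.

Section Stabilizer.
Variables (G : groupType) (T : Type) (a : gaction G T) (x : T).

Definition in_stabilizer : pred G := fun g => `[< a g x = x >].

Record stabilizer := Stabilizer {
  stabilizer_val :> G;
  stabilizerP : in_stabilizer stabilizer_val
}.

HB.instance Definition _ := [isSub for stabilizer_val].
HB.instance Definition _ := [Choice of stabilizer by <:].

Lemma stabilizer_group_closed : group_closed in_stabilizer.
Proof.
split; first by apply/asboolP; rewrite gact1.
move=> g h /asboolP gx /asboolP hx; apply/asboolP.
by rewrite -[in LHS]hx -gactM mulgVK.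
Qed.

HB.instance Definition _ :=
  SubChoice_isSubGroup.Build G in_stabilizer stabilizer
    stabilizer_group_closed.

Lemma stabilizer_act1 y : a (val (1 : stabilizer)) y = y.
Proof. by rewrite val1 gact1. Qed.

Lemma stabilizer_actM (g h : stabilizer) y :
  a (val (g * h)) y = a (val g) (a (val h) y).
Proof. by rewrite valM gactM. Qed.

Definition stabilizer_action : gaction stabilizer T :=
  @GAction stabilizer T (fun g => a (val g)) stabilizer_act1 stabilizer_actM.

End Stabilizer.

Definition fimage (T U : choiceType) (f : T -> U) (s : {fset T}) : {fset U} :=
  [fset f x | x in s]%fset.

Section SetAction.
Variables (G : groupType) (T : choiceType) (a : gaction G T).

Lemma set_act1 s : fimage (a 1) s = s.
Proof.
apply/fsetP => y; apply/imfsetP/idP => [[x xs ->] | ys].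
  by rewrite gact1.
by exists y => //; rewrite gact1.
Qed.

Lemma set_actM g h s : fimage (a (g * h)) s = fimage (a g) (fimage (a h) s).
Proof.
apply/fsetP => y; apply/imfsetP/imfsetP => [[x xs ->] | [z /imfsetP[x xs ->] ->]].
  by exists (a h x); rewrite ?gactM//; apply/imfsetP; exists x.
by exists x => //; rewrite gactM.
Qed.

Definition set_action : gaction G {fset T} :=
  @GAction G {fset T} (fun g => fimage (a g)) set_act1 set_actM.

End SetAction.

(** The letter [(x, true)] stands for [x] and [(x, false)] for its inverse. *)
Definition word (A : Type) := seq (A * bool).

Section Presentation.
Variables (A : choiceType) (R : word A -> word A -> Prop).

Inductive pres_equiv : word A -> word A -> Prop :=
| pres_refl u : pres_equiv u u
| pres_sym u v : pres_equiv u v -> pres_equiv v u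
| pres_trans u v w : pres_equiv u v -> pres_equiv v w -> pres_equiv u w
| pres_cat u u' v v' :
    pres_equiv u u' -> pres_equiv v v' -> pres_equiv (u ++ v) (u' ++ v')
| pres_cancel x b : pres_equiv [:: (x, b); (x, ~~ b)] [::]
| pres_rel u v : R u v -> pres_equiv u v.

Definition pres_equivb : rel (word A) := fun u v => `[< pres_equiv u v >].

Lemma pres_equivb_refl : reflexive pres_equivb.
Proof. by move=> u; apply/asboolP; apply: pres_refl. Qed.

Lemma pres_equivb_sym : symmetric pres_equivb.
Proof. by move=> u v; apply/asboolP/asboolP; apply: pres_sym. Qed.

Lemma pres_equivb_trans : transitive pres_equivb.
Proof.
by move=> v u w /asboolP uv /asboolP vw; apply/asboolP; apply: pres_trans vw.
Qed.

Canonical pres_equiv_rel :=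
  EquivRel pres_equivb pres_equivb_refl pres_equivb_sym pres_equivb_trans.

Definition presented := {eq_quot pres_equivb}%qT.

HB.instance Definition _ := Choice.on presented.

Definition pres_class (u : word A) : presented := (\pi_presented u)%qT.

Lemma pres_classP u v : pres_class u = pres_class v <-> pres_equiv u v.
Proof.
rewrite /pres_class; split=> [/eqmodP/asboolP //|uv].
by apply/eqmodP/asboolP.
Qed.

Lemma pres_repr (x : presented) : pres_class (repr x) = x.
Proof. exact: reprK. Qed.

Definition word_inv (u : word A) : word A := [seq (z.1, ~~ z.2) | z <- rev u].

Lemma word_invK u : word_inv (word_inv u) = u.
Proof.
rewrite /word_inv -map_rev revK -map_comp -[RHS]map_id.
by apply: eq_map => -[x b] /=; rewrite negbK.
Qed.

Lemma word_invr u : pres_equiv (u ++ word_inv u) [::].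
Proof.
elim: u => [|[x b] u IHu]; first exact: pres_refl.
rewrite /word_inv rev_cons map_rcons /= -cats1 catA -cat1s.
apply: pres_trans (pres_cancel x b).
rewrite -[[:: (x, b); _]]/([:: (x, b)] ++ [:: (x, ~~ b)]).
apply: pres_cat; first exact: pres_refl.
rewrite -[X in pres_equiv _ X]cat0s.
by apply: pres_cat => //; apply: pres_refl.
Qed.

Lemma word_invl u : pres_equiv (word_inv u ++ u) [::].
Proof. by have := word_invr (word_inv u); rewrite word_invK. Qed.

Lemma word_inv_equiv u v : pres_equiv u v -> pres_equiv (word_inv u) (word_inv v).
Proof.
move=> uv; rewrite -[word_inv u]cats0.
apply: (@pres_trans _ (word_inv u ++ (v ++ word_inv v))).
  apply: pres_cat; first exact: pres_refl.
  exact/pres_sym/word_invr.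
rewrite -[X in pres_equiv _ X]cat0s catA.
apply: pres_cat; last exact: pres_refl.
apply: pres_trans (word_invl u).
by apply: pres_cat; [apply: pres_refl | apply: pres_sym].
Qed.

Definition pres_one : presented := pres_class [::].
Definition pres_mul (x y : presented) := pres_class (repr x ++ repr y).
Definition pres_inv (x : presented) := pres_class (word_inv (repr x)).

Lemma repr_pres_class u : pres_equiv (repr (pres_class u)) u.
Proof. by apply/pres_classP; rewrite pres_repr. Qed.

Lemma pres_class_mul u v :
  pres_mul (pres_class u) (pres_class v) = pres_class (u ++ v).
Proof. by apply/pres_classP/pres_cat; apply: repr_pres_class. Qed.

Lemma pres_class_inv u : pres_inv (pres_class u) = pres_class (word_inv u).
Proof. exact/pres_classP/word_inv_equiv/repr_pres_class. Qed.

Lemma pres_mulA : associative pres_mul.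
Proof.
move=> x y z; rewrite -[x]pres_repr -[y]pres_repr -[z]pres_repr.
by rewrite !pres_class_mul catA.
Qed.

Lemma pres_mul1x : left_id pres_one pres_mul.
Proof. by move=> x; rewrite -[x]pres_repr pres_class_mul. Qed.

Lemma pres_mulx1 : right_id pres_one pres_mul.
Proof. by move=> x; rewrite -[x]pres_repr pres_class_mul cats0. Qed.

Lemma pres_mulVx : left_inverse pres_one pres_inv pres_mul.
Proof.
move=> x; rewrite -[x]pres_repr pres_class_inv pres_class_mul.
exact/pres_classP/word_invl.
Qed.

Lemma pres_mulxV : right_inverse pres_one pres_inv pres_mul.
Proof.
move=> x; rewrite -[x]pres_repr pres_class_inv pres_class_mul.
exact/pres_classP/word_invr.
Qed.

HB.instance Definition _ :=
  isGroup.Build presented pres_mulA pres_mul1x pres_mulx1 pres_mulVx pres_mulxV.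

Definition pres_gen (x : A) : presented := pres_class [:: (x, true)].

End Presentation.

(** All relations in a group are consequences of its multiplication table, so
    [singer_mul] accounts for "all relations in the groups S_i". *)
Section SingerPresentation.
Variables (S : 'I_3 -> groupType) (J : Type) (d : forall i, J -> S i).

Definition letter i (s : S i) : {i : 'I_3 & S i} * bool :=
  (Tagged (fun i => S i : Type) s, true).

Inductive singer_relation :
    word {i : 'I_3 & S i} -> word {i : 'I_3 & S i} -> Prop :=
| singer_mul i (s t : S i) :
    singer_relation [:: letter s; letter t] [:: letter (s * t)]
| singer_triangle j :
    singer_relation
      [:: letter (d (inord 0) j); letter (d (inord 1) j); letter (d (inord 2) j)]
      [::].

Definition singer_presented : groupType := presented singer_relation.

Definition singer_gen i (s : S i) : singer_presented :=
  pres_gen singer_relation (Tagged (fun i => S i : Type) s).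

End SingerPresentation.

Record incidence_structure (P L : Type) := Incidence {
  points : set P;
  lines : set L;
  incident : P -> L -> Prop
}.

Definition projective_plane (P L : Type) (E : incidence_structure P L) :=
  [/\ forall p p', points E p -> points E p' -> p <> p' ->
        exists! l, [/\ lines E l, incident E p l & incident E p' l],
      forall l l', lines E l -> lines E l' -> l <> l' ->
        exists! p, [/\ points E p, incident E p l & incident E p l']
    & exists p : 'I_4 -> P,
        [/\ injective p, forall i, points E (p i)
          & forall l i j k, lines E l -> i <> j -> j <> k -> i <> k ->
              ~ [/\ incident E (p i) l, incident E (p j) l
                  & incident E (p k) l]]].

Definition plane_order (P L : Type) (E : incidence_structure P L) (q : nat) :=
  forall l, lines E l ->
    [set p | points E p /\ incident E p l] #= `I_q.+1.

Definition acts_on_plane (P L : Type) (E : incidence_structure P L)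
    (S : groupType) (aP : gaction S P) (aL : gaction S L) :=
  [/\ forall s p, points E p -> points E (aP s p),
      forall s l, lines E l -> lines E (aL s l)
    & forall s p l, points E p -> lines E l ->
        (incident E p l <-> incident E (aP s p) (aL s l))].

Definition singer_group (P L : Type) (E : incidence_structure P L)
    (S : groupType) (aP : gaction S P) (aL : gaction S L) :=
  [/\ projective_plane E, acts_on_plane E aP aL
    & acts_regularly_on aP (points E)].

Definition difference_set (P L : Type) (E : incidence_structure P L)
    (S : groupType) (aL : gaction S L) (p : P) (l : L) : set S :=
  [set d | incident E p (aL d l)].

Definition ordered_difference_set (P L : Type) (E : incidence_structure P L)
    (S : groupType) (aL : gaction S L) (J : Type) (d : J -> S) :=
  exists p l, [/\ points E p, lines E l
    & set_bij [set: J] (difference_set E aL p l) d].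

(** A complex is its set of simplices, the empty simplex included. *)
Definition simplicial_complex (V : choiceType) (K : set {fset V}) :=
  [/\ K fset0, forall v, K [fset v]%fset
    & forall s t, K s -> (t `<=` s)%fset -> K t].

Definition complex_iso (V W : choiceType) (f : V -> W)
    (K : set {fset V}) (L : set {fset W}) :=
  set_inj [set v | K [fset v]%fset] f /\ fimage f @` K = L.

Definition automorphism (V : choiceType) (K : set {fset V}) (f : V -> V) :=
  bijective f /\ forall s, K s <-> K (fimage f s).

(** The Coxeter complex of type A~_2 is the tessellation of the Euclidean plane
    by equilateral triangles, whose vertex set is a triangular lattice, here
    written in coordinates with respect to a basis of two vectors at angle
    pi / 3. *)
Definition tile (b : bool) (u : int * int) : {fset int * int} :=
  (if b then [fset (u.1 + 1, u.2); (u.1, u.2 + 1); (u.1 + 1, u.2 + 1)]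
   else [fset u; (u.1 + 1, u.2); (u.1, u.2 + 1)])%R%fset.

Definition coxeter_complex : set {fset int * int} :=
  [set s | exists b u, (s `<=` tile b u)%fset].

Section Building.
Variables (V : choiceType) (X : set {fset V}).

Definition chambers : set {fset V} := [set c | X c /\ #|` c| = 3].

Definition panels : set {fset V} := [set p | X p /\ #|` p| = 2].

Definition chambers_on (p : {fset V}) : set {fset V} :=
  [set c | chambers c /\ (p `<=` c)%fset].

Definition thick := forall p, panels p -> `I_3 #<= chambers_on p.

Definition apartment_system (As : set (set {fset V})) :=
  [/\ forall A, As A -> A `<=` X /\ exists f, complex_iso f coxeter_complex A,
      forall s t, X s -> X t -> exists A, [/\ As A, A s & A t]
    & forall A B s t, As A -> As B -> A s -> A t -> B s -> B t ->
        exists f, complex_iso f A B /\ forall x, x \in (s `|` t)%fset -> f x = x].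

Definition building :=
  [/\ simplicial_complex X, thick & exists As, apartment_system As].

Definition locally_finite :=
  forall v, finite_set [set s | X s /\ v \in s].

Definition colouring (typ : V -> 'I_3) :=
  forall s, X s -> {in s &, injective typ}.

Definition panels_of_type (typ : V -> 'I_3) (T : {fset 'I_3}) : set {fset V} :=
  [set p | panels p /\ fimage typ p = T].

(** The two types of vertices in the link of a vertex of type i are the
    successor and the predecessor of i modulo 3.  The vertices whose type is the
    predecessor are called points, those whose type is the successor are called
    lines.  This choice fits the order of the factors in the relations
    d_0(j) d_1(j) d_2(j) = 1. *)
Definition link_plane (typ : V -> 'I_3) (v : V) : incidence_structure V V :=
  Incidence
    [set p | X [fset v; p]%fset /\ typ p = ord_pred (typ v)]
    [set l | X [fset v; l]%fset /\ typ l = ordS (typ v)]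
    (fun p l => X [fset v; p; l]%fset).

Definition acts_by_automorphisms (G : groupType) (a : gaction G V) :=
  forall g, automorphism X (a g).

(** In the locally compact group Aut(X) the stabilisers of vertices are compact
    and open.  So the group G is discrete if and only if all its vertex
    stabilisers G_w are finite; and then, for any vertex v, the Haar volume of
    G \ Aut(X) is, up to a constant factor, the sum of 1 / #|G_w| where w runs
    through representatives of the G-orbits in the Aut(X)-orbit of v. *)
Definition lattice (G : groupType) (a : gaction G V) :=
  (forall w, finite_set [set g | a g w = w]) /\
  (forall v, exists M : rat, forall ws : {fset V},
    (forall w, w \in ws -> exists f, automorphism X f /\ f v = w) ->
    (forall w w', w \in ws -> w' \in ws -> (exists g, a g w = w') -> w = w') ->
    (\sum_(w <- ws) #|` fset_set [set g | a g w = w]|%:R^-1 <= M)%R).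

End Building.

(* Main.v *)
Require Import Defs.
From HB Require Import structures.
From mathcomp Require Import all_boot all_order all_algebra finmap.
From mathcomp Require Import mathcomp_extra boolp classical_sets functions.
From mathcomp Require Import cardinality.
From mathcomp Require Import zify.

Set Implicit Arguments.
Unset Strict Implicit.
Unset Printing Implicit Defensive.

Local Open Scope classical_set_scope.
Local Open Scope card_scope.
Local Open Scope group_scope.

(** The group [G] acts freely and transitively on the edges of each of the three
    types.  In a finite plane of order [q] the stabiliser of a point acts freely
    on the [q + 1] lines through it and on all [q ^ 2 + q + 1] lines, and these
    numbers are coprime, so regularity on the lines of a vertex link gives
    regularity on its points, and conversely.

    For the presentation let [G'] be the presented group.  It maps onto [G] because
    the building is connected.  For injectivity, attach to every vertex of the
    building the lifts to [G'] of the group elements moving the base vertex there;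
    the multiplication tables and the triangle relations make this a flat system
    over the edges and chambers, and it is trivial because the building is simply
    connected.  A trivialisation is a section of [G' -> G] compatible with right
    multiplication by the vertex stabilisers, so the kernel vanishes.

    Simple connectedness comes from a discrete Morse function: the length [h] of a
    shortest path from a base vertex that uses only edges along which the type
    increases by one.  Retractions onto apartments do not increase [h], and inside
    an apartment the neighbours of a vertex with smaller [h] form a cone, whose
    apex, the neighbour minimising [h], does not depend on the apartment. *)

(** * The triangular lattice *)

Local Notation vertex := (int * int)%type.

Section TriangularLattice.
Import GRing.Theory.
Local Open Scope ring_scope.
Implicit Types u v w z : vertex.

(** The three vectors sum to zero and are the directions in which [colour] grows by one modulo 3;
    their negatives complete [hexagon]. *)
Definition pos_step u v : bool :=
  v - u \in [:: (1, 0); (-1, 1); (0, -1)].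

Definition adj u v : bool := pos_step u v || pos_step v u.

Definition tri u v w : bool := [&& adj u v, adj u w & adj v w].

(** The point reflection of [w] in the midpoint of [u] and [v]. *)
Definition across u v w : vertex := u + v - w.

(** In a basis of two vectors at angle pi / 3, the rotation by pi / 3 sends (1, 0) to (0, 1) and (0,
    1) to (-1, 1). *)
Definition rot60 u v : vertex :=
  u + (- (v - u).2, (v - u).1 + (v - u).2).

Definition turn60 (e : vertex) : vertex := (- e.2, e.1 + e.2).

Definition hexagon : seq vertex :=
  [:: (1, 0); (0, 1); (-1, 1); (-1, 0); (0, -1); (1, -1)].

Lemma adjE u v : adj u v = (v - u \in hexagon).
Proof.
rewrite /adj /pos_step -(opprB v u); case: (v - u) => x y.
by rewrite (_ : - (x, y) = (- x, - y)) // !inE !xpair_eqE /=; lia.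
Qed.

Lemma adjDl u e : adj u (u + e) = (e \in hexagon).
Proof. by rewrite adjE addrAC subrr add0r. Qed.

Lemma adjP u v : adj u v -> exists2 e : vertex, v = u + e & e \in hexagon.
Proof. by rewrite adjE => uv; exists (v - u); rewrite ?subrKC. Qed.

Lemma adj_sym u v : adj u v = adj v u.
Proof. by rewrite /adj orbC. Qed.

Lemma adj_neq u v : adj u v -> u <> v.
Proof. by move=> + uv; rewrite {}uv adjE subrr. Qed.

Lemma triD u e f :
  tri u (u + e) (u + f) = [&& e \in hexagon, f \in hexagon & f - e \in hexagon].
Proof. by rewrite /tri !adjDl adjE opprD addrACA subrr add0r. Qed.

Lemma rot60D u e : rot60 u (u + e) = u + turn60 e.
Proof. by rewrite /rot60 addrAC subrr add0r. Qed.

Lemma hexagon_ind (P : vertex -> bool) :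
  all P hexagon -> forall e, e \in hexagon -> P e.
Proof. by move/allP. Qed.

Lemma tri_rot60 u v : adj u v -> tri u v (rot60 u v).
Proof. by case/adjP=> e -> eh; rewrite rot60D triD eh; move: e eh; apply: hexagon_ind. Qed.

Lemma triP u v w : tri u v w -> w = rot60 u v \/ v = rot60 u w.
Proof.
case/and3P=> /adjP[e -> eh] /adjP[f -> fh]; rewrite adjE opprD addrACA subrr add0r.
rewrite !rot60D => efh; suff /orP[/eqP->|/eqP->] : (f == turn60 e) || (e == turn60 f).
- by left.
- by right.
apply/implyP: efh; apply/allP: f fh; apply/allP: e eh.
by vm_compute.
Qed.

Lemma subDl u e f : u + f - (u + e) = f - e.
Proof. by rewrite opprD addrACA subrr add0r. Qed.

Lemma acrossD u e f : across u (u + f) (u + e) = u + (f - e).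
Proof. by rewrite /across -addrA subDl. Qed.

(** Crossing a side of a triangle at [u] amounts to one more rotation about [u], so repeated
    crossing runs round the whole star of [u]. *)
Lemma across_rot60 u v : adj u v -> across u (rot60 u v) v = rot60 u (rot60 u v).
Proof.
case/adjP=> e -> eh; rewrite !rot60D acrossD; congr (_ + _).
by apply/eqP; apply/allP: e eh; vm_compute.
Qed.

Lemma adj_rot60 u v : adj u v -> adj u (rot60 u v).
Proof. by move/tri_rot60/and3P=> []. Qed.

Lemma adj_traject u v w : adj u v -> adj u w -> w \in traject (rot60 u) v 6.
Proof.
case/adjP=> e -> eh /adjP[f -> fh]; rewrite /= !rot60D !inE.
rewrite !(inj_eq (addrI u)); apply/allP: f fh; apply/allP: e eh.
by vm_compute.
Qed.

Lemma tri_perm u v w : tri u v w -> [/\ tri v u w, tri u w v & tri v w u].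
Proof. by rewrite /tri !(adj_sym w) (adj_sym v u) => /and3P[-> -> ->]. Qed.

Lemma acrossC u v w : across u v w = across v u w.
Proof. by rewrite /across (addrC u). Qed.

(** The tessellation is thin: this is what lets one chamber determine a chart. *)
Lemma tri_across_uniq u v w z : tri u v w -> tri u v z -> z = w \/ z = across u v w.
Proof.
case/and3P=> /adjP[e -> eh] /adjP[f -> fh] + /and3P[_ /adjP[g -> gh]].
rewrite acrossC /across (addrC (u + e)) -addrA subDl !adjE !subDl => efh egh.
suff /orP[/eqP->|/eqP->] : (g == f) || (g == e - f); [by left|by right|].
apply/implyP: egh; apply/implyP: efh; apply/allP: g gh; apply/allP: f fh.
by apply/allP: e eh; vm_compute.
Qed.

Lemma tri_across u v w : tri u v w -> tri u v (across u v w).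
Proof.
case/and3P=> /adjP[e -> eh] /adjP[f -> fh].
rewrite acrossC /across (addrC (u + e)) -addrA subDl triD adjE subDl eh => efh.
by apply/implyP: efh; apply/allP: f fh; apply/allP: e eh; vm_compute.
Qed.

Lemma tri_neq_across u v w : tri u v w -> w != across u v w.
Proof.
case/and3P=> /adjP[e -> eh] /adjP[f -> fh].
rewrite acrossC /across (addrC (u + e)) -addrA subDl (inj_eq (addrI u)) adjE subDl.
by move=> efh; apply/implyP: efh; apply/allP: f fh; apply/allP: e eh; vm_compute.
Qed.

(* Two triangles with a common edge are exchanged by the point reflection in its
   midpoint, and these reflections generate the whole tessellation. *)
Lemma tri_propagation (P : vertex -> Prop) u0 v0 w0 :
  (forall u v w, tri u v w -> P u -> P v -> P w -> P (across u v w)) ->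
  tri u0 v0 w0 -> P u0 -> P v0 -> P w0 -> forall u, P u.
Proof.
move=> step.
(* Crossing successive sides at [u] carries [P] round the hexagon of neighbours of [u]. *)
have star u v w : tri u v w -> P u -> P v -> P w -> forall z, adj u z -> P z.
  wlog -> : v w / w = rot60 u v => [hwlog|].
    move=> t; case: (triP t) => E; first exact: (hwlog v w).
    by move=> Pu Pv Pw; apply: (hwlog w v) => //; case: (tri_perm t).
  case/and3P=> uv _ _ Pu Pv Pw z uz.
  have Pr x : adj u x -> P x -> P (rot60 u x) -> P (rot60 u (rot60 u x)).
    move=> ux Px Prx; rewrite -across_rot60 //; apply: step => //.
    by case: (tri_perm (tri_rot60 ux)).
  have Pn n : [/\ adj u (iter n (rot60 u) v), P (iter n (rot60 u) v)
                 & P (iter n.+1 (rot60 u) v)].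
    elim: n => [|n [un Pn PSn]] //; split => //; first exact: adj_rot60.
    exact: Pr.
  by case/trajectP: (adj_traject uv uz) => n _ ->; case: (Pn n).
(* Including the neighbours makes the property pass along single edges; moving in the two coordinate
   directions then reaches every vertex. *)
pose N u := P u /\ forall z, adj u z -> P z.
have Nadj u v : adj u v -> N u -> N v.
  move=> uv [Pu Nu]; have t := tri_rot60 uv; split; first exact: Nu.
  have [t' _ _] := tri_perm t.
  apply: (star _ _ _ t') => //; first exact: Nu.
  exact/Nu/adj_rot60.
move=> t Pu0 Pv0 Pw0.
have N0 : N u0 by split => //; apply: star t _ _ _.
have Nx n : N (u0 + (n, 0)).
  elim: n => [|n IHn|n IHn]; first by rewrite addr0.
  - by apply: Nadj IHn; rewrite adjE subDl; case: (n) => *; rewrite !inE !xpair_eqE/=; lia.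
  - by apply: Nadj IHn; rewrite adjE subDl; case: (n) => *; rewrite !inE !xpair_eqE/=; lia.
have Nxy n m : N (u0 + (n, m)).
  elim: m => [|m IHm|m IHm]; first exact: Nx.
  - by apply: Nadj IHm; rewrite adjE subDl; rewrite !inE !xpair_eqE/=; lia.
  - by apply: Nadj IHm; rewrite adjE subDl; rewrite !inE !xpair_eqE/=; lia.
move=> u; have [] := Nxy (u - u0).1 (u - u0).2.
by rewrite -surjective_pairing subrKC.
Qed.

Definition colour u : 'I_3 := (u.1 - u.2)%:~R : 'Z_3.

Lemma colourD u v : colour (u + v) = colour u + colour v :> 'Z_3.
Proof. by rewrite /colour -intrD/= opprD addrACA. Qed.

Lemma adj_colour u v : adj u v ->
  if pos_step u v then colour v = colour u + 1 :> 'Z_3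
  else colour v = colour u - 1 :> 'Z_3.
Proof.
case/adjP=> e -> eh; rewrite colourD.
have -> : pos_step u (u + e) = (e \in [:: (1, 0); (-1, 1); (0, -1)]).
  by rewrite /pos_step addrAC subrr add0r.
suff : if e \in [:: (1, 0); (-1, 1); (0, -1)] then colour e == 1 :> 'Z_3
       else colour e == -1 :> 'Z_3 by case: ifP => _ /eqP ->.
by apply/allP: e eh; vm_compute.
Qed.

Lemma adj_colour_neq u v : adj u v -> colour u <> colour v.
Proof.
by move=> uv E; move: (adj_colour uv); rewrite E; case: ifP => _ /eqP;
  rewrite -subr_eq0 opprD addNKr.
Qed.

(** The neighbours of [o] form a 6-cycle, in which the closed walk [a], [b], [u], [w] of length four
    must backtrack. *)
Lemma hexagon_no_square o a b u w : tri o a b -> adj o u -> adj o w ->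
  adj u w -> adj a w -> adj u b -> u = a \/ w = b.
Proof.
case/and3P=> /adjP[e -> eh] /adjP[f -> fh]; rewrite adjE subDl => efh.
case/adjP=> g -> gh /adjP[k -> kh]; rewrite !adjE !subDl => H1 H2 H3.
rewrite !(rwP eqP) !(inj_eq (addrI o)); apply/orP.
apply/implyP: H3; apply/implyP: H2; apply/implyP: H1.
apply/allP: k kh; apply/allP: g gh; apply/implyP: efh.
by apply/allP: f fh; apply/allP: e eh; vm_compute.
Qed.

(** Colours alternate round the hexagon, so [a] and [b] are at angle 2 pi / 3 or the opposite one
    seen from [o], and the sum of the two directions is the direction between them. *)
Lemma hexagon_common_neighbour o a b : adj o a -> adj o b -> a <> b ->
  colour a = colour b -> exists c, tri o a c /\ tri o b c.
Proof.
case/adjP=> e -> eh /adjP[f -> fh] ef; rewrite !colourD => /addrI cef.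
have {}ef : e != f by apply/eqP => E; apply: ef; rewrite E.
exists (o + (e + f)); rewrite !triD eh fh /= addrAC subrr add0r addrK eh fh andbT.
suff -> : e + f \in hexagon by [].
move/eqP: cef => cef; apply/implyP: ef; apply/implyP: cef.
by apply/allP: f fh; apply/allP: e eh; vm_compute.
Qed.
End TriangularLattice.

(** * Directed distance from the origin in the lattice *)

Section Height.
Import GRing.Theory.
Local Open Scope ring_scope.
Implicit Types u v w : vertex.

(* Write [u] as [i (1, 0) + j (-1, 1) + k (0, -1)] with [i], [j], [k] nonnegative
   and at least one of them zero; then [height u] is [i + j + k], the number of
   positive steps from the origin to [u]. *)
Definition height u : nat :=
  `|(u.1 + 2 * u.2 + 3 * Num.max 0 (Num.max (- u.2) (- (u.1 + u.2))))%R|%N.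

Lemma hexagon_case (P : vertex -> Prop) :
  P (1, 0) -> P (0, 1) -> P (-1, 1) -> P (-1, 0) -> P (0, -1) -> P (1, -1) ->
  forall e, e \in hexagon -> P e.
Proof.
move=> ? ? ? ? ? ? e; rewrite !inE.
move/orP=> [/eqP->|] //.
by do ![move/orP=> [/eqP->|] // | move/eqP=> -> //].
Qed.

Lemma height_pos_step u v : pos_step u v -> (height v <= (height u).+1)%N.
Proof.
rewrite /pos_step -{2}(subrKC u v) !inE; case: u => x y.
by case/or3P=> /eqP->; rewrite /height /=; lia.
Qed.

Lemma height_pred u : u != 0 -> exists2 w, pos_step w u & height u = (height w).+1.
Proof.
case: u => x y; rewrite xpair_eqE => u0.
suff [e ee he] : exists2 e : vertex,
    e \in [:: (1, 0); (-1, 1); (0, -1)] & height (x, y) = (height ((x, y) - e)).+1.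
  by exists ((x, y) - e) => //; rewrite /pos_step opprB subrKC.
(* As the smallest of the coefficients [i], [j], [k] is zero, a coefficient is positive exactly when
   it exceeds one of the other two; a step with positive coefficient is then removed. *)
have : [|| (0 < x) || (0 < x + y), (0 < y) || (x < 0) | (y < 0) || (x + y < 0)].
  by move: u0; lia.
case/or3P=> H; [exists (1, 0)|exists (-1, 1)|exists (0, -1)] => //;
  case/orP: H => H {u0}; rewrite /height/=; lia.
Qed.

Lemma height_neq u v : adj u v -> height u != height v.
Proof.
case/adjP=> e ->; move: e; case: u => x y.
by apply: hexagon_case; rewrite /height/=; lia.
Qed.

(** If two of the coefficients [i], [j], [k] of [u] are positive, adding the third step lowers both,
    so the height drops by two, and the other two lower neighbours flank this one. If only one is
    positive, removing its step gives the only lower neighbour. The six cases of the proof are these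
    three sectors and three rays. *)
Lemma height_min u : u != 0 -> exists v0,
  [/\ adj u v0, (height v0 < height u)%N,
      forall v, adj u v -> (height v <= height v0)%N -> v = v0
    & forall v, adj u v -> (height v < height u)%N -> v = v0 \/ tri u v0 v].
Proof.
move=> u0.
suff [f fh [lt0 min0 desc0]] : exists2 f : vertex, f \in hexagon &
  [/\ (height (u + f)%R < height u)%N,
      forall e, e \in hexagon -> (height (u + e)%R <= height (u + f)%R)%N -> e == f
    & forall e, e \in hexagon -> (height (u + e)%R < height u)%N ->
        (e == f) || (e - f \in hexagon)].
  exists (u + f); split => //; first by rewrite adjDl.
    by move=> v /adjP[e -> eh] /(min0 _ eh)/eqP->.
  move=> v /adjP[e -> eh] /(desc0 _ eh)/orP[/eqP->|efh]; first by left.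
  by right; rewrite triD fh eh.
case: u u0 => x y; rewrite xpair_eqE => u0.
have : [|| (0 < x + y) && (0 < y), (y < 0) && (0 < x), (x < 0) && (x + y < 0),
  (0 < x) && (y == 0), (x < 0) && (x + y == 0) | (x == 0) && (y < 0)].
  by move: u0 => /=; lia.
case/or4P=> [H|H|H|/or3P[H|H|H]];
  [exists (0, -1)|exists (-1, 1)|exists (1, 0)|exists (-1, 0)|exists (1, -1)|exists (0, 1)] => //;
  split; (try by move: H; rewrite /height/=; lia);
  apply: hexagon_case => //; by move: H; rewrite /height/=; lia.
Qed.
End Height.

(** * Images of finite sets *)

Section FiniteImages.
Variables T U : choiceType.
Implicit Types (f : T -> U) (s t : {fset T}).

Lemma fimageP f s y : reflect (exists2 x, x \in s & y = f x) (y \in fimage f s).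
Proof. by apply: (iffP (imfsetP _ _ _ _)) => -[x xs ->]; exists x. Qed.

Lemma mem_fimage f s x : x \in s -> f x \in fimage f s.
Proof. by move=> xs; apply/fimageP; exists x. Qed.

Lemma fimage1 f x : fimage f [fset x]%fset = [fset f x]%fset.
Proof.
apply/fsetP=> y; rewrite in_fset1; apply/fimageP/eqP => [[z]|->].
  by rewrite in_fset1 => /eqP ->.
by exists x; rewrite ?in_fset1.
Qed.

Lemma fimageU f s t : fimage f (s `|` t)%fset = (fimage f s `|` fimage f t)%fset.
Proof.
apply/fsetP=> y; rewrite in_fsetU; apply/fimageP/orP => [[z]|].
  by rewrite in_fsetU => /orP[zs|zt] ->; [left|right]; apply: mem_fimage.
by case=> /fimageP[z zs ->]; exists z; rewrite // in_fsetU zs ?orbT.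
Qed.

Lemma fimage2 f x y : fimage f [fset x; y]%fset = [fset f x; f y]%fset.
Proof. by rewrite fimageU !fimage1. Qed.

Lemma fimage3 f x y z : fimage f [fset x; y; z]%fset = [fset f x; f y; f z]%fset.
Proof. by rewrite fimageU fimage2 fimage1. Qed.

Lemma fimage_sub f s t : (s `<=` t)%fset -> (fimage f s `<=` fimage f t)%fset.
Proof.
move=> /fsubsetP st; apply/fsubsetP=> y /fimageP[x xs ->].
exact/mem_fimage/st.
Qed.

Lemma mem_fimage_inj f s x : injective f -> (f x \in fimage f s) = (x \in s).
Proof.
by move=> fI; apply/fimageP/idP => [[y ys /fI->]//|xs]; exists x.
Qed.
End FiniteImages.

Lemma fimage_comp (T U W : choiceType) (g : U -> W) (f : T -> U) s : fimage (g \o f) s = fimage g (fimage f s).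
Proof.
apply/fsetP=> y; apply/fimageP/fimageP => [[x xs ->]|[z /fimageP[x xs ->] ->]].
  by exists (f x); rewrite ?mem_fimage.
by exists x.
Qed.

Lemma fimage_id (T : choiceType) (s : {fset T}) : fimage id s = s.
Proof.
by apply/fsetP=> x; apply/fimageP/idP => [[y ys ->]//|xs]; exists x.
Qed.

(** * Simplices and symmetries of the tessellation *)

Section CoxeterComplex.
Import GRing.Theory.
Local Open Scope ring_scope.
Implicit Types u v w : vertex.

Lemma tile_adj b x u v : u \in tile b x -> v \in tile b x -> u = v \/ adj u v.
Proof.
rewrite /tile; case: b; case: x => x y; rewrite !inE => /orP[/orP[]|] /eqP-> /orP[/orP[]|] /eqP->;
  first [by left | right; rewrite adjE !inE !xpair_eqE/=; lia].
Qed.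

Lemma cox_adj s u v : coxeter_complex s -> u \in s -> v \in s -> u = v \/ adj u v.
Proof. by case=> b [x] /fsubsetP st /st uT /st; apply: tile_adj uT. Qed.

Lemma cox_sub s t : coxeter_complex s -> (t `<=` s)%fset -> coxeter_complex t.
Proof. by case=> b [x] sx ts; exists b, x; apply: fsubset_trans sx. Qed.

Lemma cox_tri u v w : tri u v w -> coxeter_complex [fset u; v; w]%fset.
Proof.
wlog -> : v w / w = rot60 u v => [hwlog t|].
  case: (triP t) => E; first exact: (hwlog v w).
  have [_ t' _] := tri_perm t; rewrite fsetUAC; exact: (hwlog w v).
case/and3P=> /adjP[e -> eh] _ _; rewrite rot60D.
suff [b [x xE]] : exists b x, [/\ u \in tile b x, u + e \in tile b x
    & u + turn60 e \in tile b x].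
  exists b, x; case: xE => ? ? ?; apply/fsubsetP => z.
  by rewrite !inE => /orP[/orP[]|] /eqP->.
(* Going round [u], the six triangles alternate between the two kinds of tiles. *)
case: u => x y; move: e eh; rewrite /tile; apply: hexagon_case.
- by exists false, (x, y); rewrite !inE !xpair_eqE /=; split; lia.
- by exists true, (x - 1, y); rewrite !inE !xpair_eqE /=; split; lia.
- by exists false, (x - 1, y); rewrite !inE !xpair_eqE /=; split; lia.
- by exists true, (x - 1, y - 1); rewrite !inE !xpair_eqE /=; split; lia.
- by exists false, (x, y - 1); rewrite !inE !xpair_eqE /=; split; lia.
- by exists true, (x, y - 1); rewrite !inE !xpair_eqE /=; split; lia.
Qed.

Lemma cox1 u : coxeter_complex [fset u]%fset.
Proof.
exists false, u; apply/fsubsetP => z; rewrite /tile !inE => /eqP->.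
by rewrite eqxx.
Qed.

Lemma cox_adj2 u v : adj u v -> coxeter_complex [fset u; v]%fset.
Proof.
move=> /tri_rot60/cox_tri/cox_sub; apply; apply/fsubsetP=> z.
by rewrite !inE => ->.
Qed.

Lemma cox_triangle u v w : u <> v -> u <> w -> v <> w ->
  coxeter_complex [fset u; v; w]%fset -> tri u v w.
Proof.
move=> uv uw vw c.
have H x y : x <> y -> x \in [fset u; v; w]%fset -> y \in [fset u; v; w]%fset -> adj x y.
  by move=> xy xc yc; case: (cox_adj c xc yc).
by apply/and3P; split; apply: H; rewrite // !inE eqxx ?orbT.
Qed.

Lemma cox_translate s t : coxeter_complex s -> coxeter_complex (fimage (+%R t) s).
Proof.
case=> b [x sx]; exists b, (t + x); apply: (fsubset_trans (fimage_sub _ sx)).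
apply/fsubsetP=> z; rewrite /tile; case: b {sx}; case: x t => [x y] [a b];
  rewrite fimage3 !inE => /orP[/orP[]|] /eqP->; rewrite !xpair_eqE/=; lia.
Qed.

(** A reflection fixing the origin and negating [colour]; it serves to correct the orientation of a
    chart. *)
Definition transpose u : vertex := (u.2, u.1).

Lemma transposeK : involutive transpose.
Proof. by case. Qed.

Lemma cox_transpose s : coxeter_complex s -> coxeter_complex (fimage transpose s).
Proof.
case=> b [x sx]; exists b, (transpose x); apply: (fsubset_trans (fimage_sub _ sx)).
apply/fsubsetP=> z; rewrite /tile; case: b {sx}; case: x => [x y];
  rewrite fimage3 !inE => /orP[/orP[]|] /eqP->; rewrite !xpair_eqE/=; lia.
Qed.
End CoxeterComplex.

(** * Charts, retractions and links *)

Section Charts.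
Variables (V : choiceType) (X : set {fset V}) (typ : V -> 'I_3).
Variable As : set (set {fset V}).
Hypotheses (X_complex : simplicial_complex X).
Hypotheses (X_apartments : apartment_system X As).
Hypotheses (X_typ : colouring X typ).
Implicit Types (phi psi chi : vertex -> V) (s t : {fset V}).

(* A chart is a parametrisation of an apartment; two charts with the same
   [in_chart] parametrise the same apartment. *)
Definition chart phi := exists2 A, As A & complex_iso phi coxeter_complex A.

Definition in_chart phi s := exists2 s', coxeter_complex s' & fimage phi s' = s.

Lemma chart_inj phi : chart phi -> injective phi.
Proof. by case=> A _ [phiI _] u v; apply: phiI; rewrite inE; apply: cox1. Qed.

Lemma chart_simplex phi s : chart phi -> in_chart phi s -> X s.
Proof.
case=> A AsA [_ AE] [s' s'c <-]; have [/(_ A AsA)[+ _] _ _] := X_apartments.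
by apply; rewrite -AE; exists s'.
Qed.

Lemma complex_iso_comp (U T W : choiceType) (f : U -> T) (g : T -> W) K L M :
  complex_iso f K L -> complex_iso g L M -> complex_iso (g \o f) K M.
Proof.
move=> [fI <-] [gI <-]; split.
  move=> u v; rewrite !inE => Ku Kv /gI E; apply: fI; rewrite ?inE //.
  by apply: E; rewrite inE; [exists [fset u]%fset|exists [fset v]%fset]; rewrite ?fimage1.
apply/seteqP; split=> s /=.
  by case=> t Kt <-; exists (fimage f t); [exists t|rewrite fimage_comp].
by case=> _ [t Kt <-] <-; exists t => //; rewrite fimage_comp.
Qed.

Lemma chart_cover s t : X s -> X t ->
  exists phi, [/\ chart phi, in_chart phi s & in_chart phi t].
Proof.
have [H1 H2 _] := X_apartments.
move=> Xs Xt; have [A [AsA As1 At]] := H2 _ _ Xs Xt.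
have [_ [phi phiA]] := H1 A AsA; exists phi; split; first by exists A.
  by move: As1; case: phiA => _ <- [s' ? <-]; exists s'.
by move: At; case: phiA => _ <- [s' ? <-]; exists s'.
Qed.

(** Compose [phi] with the isomorphism of apartments that fixes [s] and [t]. *)
Lemma chart_exchange phi psi s t : chart phi -> chart psi ->
  in_chart phi s -> in_chart phi t -> in_chart psi s -> in_chart psi t ->
  exists chi, [/\ chart chi, in_chart chi = in_chart psi
    & forall u, phi u \in (s `|` t)%fset -> chi u = phi u].
Proof.
move=> [A AsA iA] [B AsB iB] As1 At Bs Bt.
have [_ _ H3] := X_apartments.
have inA chi C r : complex_iso chi coxeter_complex C -> in_chart chi r <-> C r.
  by case=> _ <-; split=> -[r' ? <-]; exists r'.
have [f [fAB fE]] := H3 A B s t AsA AsB (proj1 (inA _ _ _ iA) As1)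
  (proj1 (inA _ _ _ iA) At) (proj1 (inA _ _ _ iB) Bs) (proj1 (inA _ _ _ iB) Bt).
have icB := complex_iso_comp iA fAB.
exists (f \o phi); split; first by exists B.
  apply/funext=> r; apply/propext; rewrite (inA _ B) // -(inA psi) //.
by move=> u /fE.
Qed.

Lemma chart_reparam phi (f g : vertex -> vertex) : chart phi ->
  cancel f g -> cancel g f ->
  (forall s : {fset vertex}, coxeter_complex s -> coxeter_complex (fimage f s)) ->
  (forall s : {fset vertex}, coxeter_complex s -> coxeter_complex (fimage g s)) ->
  chart (phi \o f) /\ in_chart (phi \o f) = in_chart phi.
Proof.
move=> [A AsA iA] fK gK fc gc.
have fi : complex_iso f coxeter_complex coxeter_complex.
  split=> [|]; first by move=> u v _ _ /(can_inj fK).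
  apply/seteqP; split=> s /=; first by case=> t tc <-; apply: fc.
  move=> sc; exists (fimage g s); first exact: gc.
  by rewrite -fimage_comp (_ : f \o g = id) ?fimage_id //; apply/funext.
have fA := complex_iso_comp fi iA; split; first by exists A.
apply/funext=> s; apply/propext; case: iA fA => _ E [_ E'].
by rewrite -[in_chart _ s]/((fimage (phi \o f) @` coxeter_complex) s) E' -E.
Qed.

Lemma chart_tri phi u v w : chart phi -> tri u v w ->
  in_chart phi [fset phi u; phi v; phi w]%fset.
Proof. by move=> ? /cox_tri c; eexists; [exact: c|rewrite fimage3]. Qed.

Lemma chart_adj phi u v : chart phi -> adj u v -> in_chart phi [fset phi u; phi v]%fset.
Proof. by move=> ? /cox_adj2 c; eexists; [exact: c|rewrite fimage2]. Qed.

Lemma in_chart_mem phi s x : in_chart phi s -> x \in s -> exists u, phi u = x.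
Proof. by case=> s' _ <- /fimageP[u _ ->]; exists u. Qed.

Lemma in_chart_cox phi (s : {fset vertex}) : chart phi -> in_chart phi (fimage phi s) -> coxeter_complex s.
Proof.
move=> /chart_inj phiI [s' s'c E]; suff -> : s = s' by [].
by apply/fsetP=> u; rewrite -(mem_fimage_inj _ _ phiI) -E mem_fimage_inj.
Qed.

Lemma in_chart_adj phi s u v : chart phi -> in_chart phi s ->
  phi u \in s -> phi v \in s -> u = v \/ adj u v.
Proof.
move=> /chart_inj phiI [s' s'c <-]; rewrite !mem_fimage_inj //.
exact: cox_adj.
Qed.

Lemma in_chart_tri phi u v w : chart phi -> in_chart phi [fset phi u; phi v; phi w]%fset ->
  u <> v -> u <> w -> v <> w -> tri u v w.
Proof.
by move=> pc c ? ? ?; apply: cox_triangle => //; apply: in_chart_cox pc _; rewrite fimage3.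
Qed.

Lemma typ_chart phi u v : chart phi -> adj u v -> typ (phi u) <> typ (phi v).
Proof.
move=> pc uv E; have Xs := chart_simplex pc (chart_adj pc uv).
by apply: (adj_neq uv); apply: (chart_inj pc); apply: (X_typ Xs); rewrite // !inE eqxx ?orbT.
Qed.

(** Agreement propagates across edges: in the common apartment an edge lies in only two triangles,
    and injectivity excludes the one already used. *)
Lemma chart_rigid phi psi a b c : chart phi -> chart psi ->
  in_chart phi = in_chart psi -> tri a b c ->
  phi a = psi a -> phi b = psi b -> phi c = psi c -> forall u, phi u = psi u.
Proof.
move=> pc qc E; apply: tri_propagation => u v w t Eu Ev Ew.
have to := tri_across t; have := chart_tri pc to; rewrite E => c'.
have [z pz] : exists z, psi z = phi (across u v w).
  by apply: (in_chart_mem c'); rewrite !inE eqxx ?orbT.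
have tz : tri u v z.
  case/and3P: to => _ uo vo; case/and3P: t => uv _ _.
  apply: (in_chart_tri qc); rewrite -?Eu -?Ev ?pz //.
  - exact: adj_neq.
  - by move=> uz; move: pz; rewrite -uz -Eu => /(chart_inj pc); apply: adj_neq.
  - by move=> uz; move: pz; rewrite -uz -Ev => /(chart_inj pc); apply: adj_neq.
case: (tri_across_uniq t tz) => zE; last by rewrite -{1}pz zE.
move: pz; rewrite zE -Ew => /(chart_inj pc) wo.
by have := tri_neq_across t; rewrite -wo.
Qed.

Import GRing.Theory.

Lemma ord3_third (x y z w : 'I_3) :
  x <> y -> z <> x -> z <> y -> w <> x -> w <> y -> z = w.
Proof.
move=> xy zx zy wx wy; apply/val_inj.
have neq (i j : 'I_3) : i <> j -> val i <> val j by move=> + /val_inj.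
move: (neq _ _ xy) (neq _ _ zx) (neq _ _ zy) (neq _ _ wx) (neq _ _ wy).
case: x y z w {xy zx zy wx wy neq} => [a ?] [b ?] [c ?] [d ?] /=; lia.
Qed.

(** With three colours, two vertices of a triangle determine the colour of the third, so agreement
    propagates from one triangle. *)
Lemma proper_colouring_rigid (c c' : vertex -> 'I_3) u v w :
  (forall u v, adj u v -> c u <> c v) -> (forall u v, adj u v -> c' u <> c' v) ->
  tri u v w -> c u = c' u -> c v = c' v -> c w = c' w -> forall z, c z = c' z.
Proof.
move=> cP c'P; apply: tri_propagation => {}u {}v {}w t Eu Ev Ew.
case/and3P: (t) => uv uw vw; case/and3P: (tri_across t) => _ uz vz.
apply: (@ord3_third (c u) (c v)); rewrite ?Eu ?Ev; try exact: c'P;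
  rewrite -?Eu -?Ev; try exact: cP; apply/nesym; try exact: cP.
all: by rewrite ?Eu ?Ev; exact: c'P.
Qed.

(** The type condition fixes the orientation: positive steps of the lattice become edges along which
    the type increases by one. *)
Definition typed_chart o phi := [/\ chart phi, phi (0, 0)%R = o &
  forall u, typ (phi u) = (typ o + colour u)%R :> 'Z_3].

Lemma chart_typed phi : chart phi ->
  typ (phi (1, 0)%R) = (typ (phi (0, 0)%R) + 1)%R :> 'Z_3 ->
  typed_chart (phi (0, 0)%R) phi.
Proof.
move=> pc E; split => //.
pose c' u : 'I_3 := (typ (phi (0, 0)%R) + colour u)%R : 'Z_3.
have c'P u v : adj u v -> c' u <> c' v.
  by move=> uv /addrI; apply: adj_colour_neq.
have cP u v : adj u v -> typ (phi u) <> typ (phi v) by apply: typ_chart.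
have t : tri (0, 0)%R (1, 0)%R (0, 1)%R by vm_compute.
have E0 : typ (phi (0, 0)%R) = c' (0, 0)%R by rewrite /c' /colour subrr addr0.
have E1 : typ (phi (1, 0)%R) = c' (1, 0)%R by rewrite /c' E; congr (_ + _)%R; apply/val_inj.
case/and3P: (t) => t01 t02 t12.
apply: (@proper_colouring_rigid (typ \o phi) c' _ _ _ _ _ t) => //=.
apply: (@ord3_third (typ (phi (0, 0)%R)) (typ (phi (1, 0)%R))); try exact: cP;
  try (by apply/nesym/cP).
  by rewrite E0; apply/nesym/c'P.
by rewrite E1; apply/nesym/c'P.
Qed.

Lemma typed_chart_normalise phi u : chart phi ->
  exists2 psi, typed_chart (phi u) psi & in_chart psi = in_chart phi.
Proof.
move=> pc; pose phi1 := phi \o (+%R u).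
have [p1c E1] : chart phi1 /\ in_chart phi1 = in_chart phi.
  apply: (@chart_reparam _ _ (+%R (- u)%R)) => //.
  - by move=> v; rewrite addKr.
  - by move=> v; rewrite addNKr.
  - by move=> s; apply: cox_translate.
  - by move=> s; apply: cox_translate.
have p10 : phi1 (0, 0)%R = phi u by rewrite /phi1 /= addr0.
pose phi2 := phi1 \o transpose.
have [p2c E2] : chart phi2 /\ in_chart phi2 = in_chart phi1.
  by apply: (@chart_reparam _ _ transpose) => //;
    [exact: transposeK|exact: transposeK|exact: cox_transpose|exact: cox_transpose].
have [T|T] := eqVneq (typ (phi1 (1, 0)%R)) (typ (phi u) + 1 : 'Z_3)%R.
  by exists phi1 => //; rewrite -p10; apply: chart_typed; rewrite // p10.
(* When (1, 0) has the wrong type, the third vertex (0, 1) of the triangle has the right one, and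
   the transposition exchanges them. *)
exists phi2; last by rewrite E2.
have -> : phi u = phi2 (0, 0)%R by rewrite -p10.
apply: chart_typed => //; rewrite -[phi2 (0,0)%R]/(phi1 (0, 0)%R).
rewrite -[phi2 (1,0)%R]/(phi1 (0, 1)%R).
have cP v w : adj v w -> typ (phi1 v) <> typ (phi1 w) by apply: typ_chart.
apply: (@ord3_third (typ (phi1 (0, 0)%R)) (typ (phi1 (1, 0)%R))).
- by apply: cP; vm_compute.
- by apply: cP; vm_compute.
- by apply: cP; vm_compute.
- rewrite -[in X in _ <> X]/(typ (phi1 (0, 0)%R) : 'Z_3) => /eqP.
  by rewrite -subr_eq0 addrAC subrr.
- by rewrite p10; apply/eqP; rewrite eq_sym.
Qed.

Lemma typed_chart_cover o s t : X s -> X t -> o \in s ->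
  exists phi, [/\ typed_chart o phi, in_chart phi s & in_chart phi t].
Proof.
move=> Xs Xt os; have [phi [pc ps pt]] := chart_cover Xs Xt.
have [u <-] := in_chart_mem ps os.
by have [psi ? E] := typed_chart_normalise u pc; exists psi; rewrite E.
Qed.

(* The retraction onto the apartment of [phi] centred at the image of the chamber
   [a b c], in the coordinates given by [phi]. *)
Lemma retraction phi a b c : chart phi -> tri a b c -> exists r : V -> vertex,
  [/\ forall u, r (phi u) = u,
      forall x, typ (phi (r x)) = typ x,
      forall x y, X [fset x; y]%fset -> x <> y -> adj (r x) (r y)
    & forall x d, d \in [:: a; b; c] -> r x = d -> x = phi d].
Proof.
move=> pc t.
pose C := [fset phi a; phi b; phi c]%fset.
have [CphiP aC bC cC] : [/\ in_chart phi C, phi a \in C, phi b \in C & phi c \in C].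
  by split; [exact: chart_tri | rewrite !inE eqxx ?orbT ..].
(* The retraction reads off the coordinate of a vertex in any chart agreeing with [phi] on the
   central chamber. *)
pose centred chi := [/\ chart chi, chi a = phi a, chi b = phi b & chi c = phi c].
have cC' chi : centred chi -> in_chart chi C.
  by rewrite /C; move=> [cc <- <- <-]; apply: chart_tri.
have cover s : X s -> exists2 chi, centred chi & in_chart chi s.
  move=> Xs; have XC := chart_simplex pc CphiP.
  have [psi [psc pC ps]] := chart_cover XC Xs.
  have [chi [cc E chiE]] := chart_exchange pc psc CphiP CphiP pC pC.
  exists chi; last by rewrite E.
  by split => //; apply: chiE; rewrite fsetUid.
(* Well-definedness: exchange gives a chart [om] of the apartment of [chi'] agreeing with [chi] on
   the chamber and at [u]; by rigidity [om] is [chi']. *)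
have inj chi chi' u u' : centred chi -> centred chi' -> chi u = chi' u' -> u = u'.
  move=> cchi cchi' E; have [cc ca cb cd] := cchi; have [cc' ca' cb' cd'] := cchi'.
  have in1 psi v : in_chart psi [fset psi v]%fset.
    by exists [fset v]%fset; [exact: cox1|rewrite fimage1].
  have c'u : in_chart chi' [fset chi u]%fset by rewrite E.
  have [om [oc oE omE]] :=
    chart_exchange cc cc' (cC' _ cchi) (in1 _ u) (cC' _ cchi') c'u.
  have omu : om u = chi u by apply: omE; rewrite !inE eqxx orbT.
  have R : forall v, om v = chi' v.
    by apply: (chart_rigid oc cc' oE t); rewrite omE ?ca ?cb ?cd // in_fsetU ?aC ?bC ?cC.
  by apply: (chart_inj oc); rewrite omu R.
have X1 x : X [fset x]%fset by case: X_complex.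
have /choice[r rP] : forall x, exists u, forall chi w, centred chi -> chi w = x -> w = u.
  move=> x; have [chi cc /in_chart_mem] := cover _ (X1 x).
  case/(_ x); first by rewrite in_fset1.
  by move=> u E; exists u => chi' w cc' E'; apply: (inj chi' chi); rewrite ?E.
have rK chi u : centred chi -> r (chi u) = u by move=> cc; rewrite -(rP _ _ _ cc erefl).
have cphi : centred phi by [].
exists r; split.
- by move=> u; apply: rK.
- move=> x; have [chi cc /in_chart_mem] := cover _ (X1 x).
  case/(_ x); first by rewrite in_fset1.
  move=> u E; rewrite -{}E rK //; have [cc1 ca cb cd] := cc.
  apply: (@proper_colouring_rigid (typ \o phi) (typ \o chi) a b c); rewrite //= ?ca ?cb ?cd //.
  + by move=> ? ?; apply: typ_chart.
  + by move=> ? ?; apply: typ_chart.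
- move=> x y Xxy xy; have [chi cc ic] := cover _ Xxy.
  have [|u uE] := in_chart_mem ic (x := x); first by rewrite !inE eqxx.
  have [|v vE] := in_chart_mem ic (x := y); first by rewrite !inE eqxx orbT.
  have cc1 : chart chi by case: cc.
  rewrite -uE -vE !rK //.
  case: (@in_chart_adj chi _ u v cc1 ic) => //; rewrite ?uE ?vE ?inE ?eqxx ?orbT //.
  by move=> E; case: xy; rewrite -uE -vE E.
- move=> x d dabc; have [chi cc /in_chart_mem] := cover _ (X1 x).
  case/(_ x); first by rewrite in_fset1.
  move=> u <-; rewrite rK // => ->; case: cc => _ ? ? ?.
  by move: dabc; rewrite !inE => /or3P[]/eqP->.
Qed.

(** * The Morse function and simple connectedness *)

Definition edge x y := X [fset x; y]%fset /\ x <> y.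

Lemma edge_sym x y : edge x y -> edge y x.
Proof. by move=> [Xxy xy]; split; [rewrite fsetUC | apply/nesym]. Qed.

Lemma chart_edge phi u v : chart phi -> adj u v -> edge (phi u) (phi v).
Proof.
move=> pc uv; split; first exact: chart_simplex (chart_adj pc uv).
by move=> /(chart_inj pc); apply: adj_neq.
Qed.

Lemma chart_triangle phi u v w : chart phi -> tri u v w ->
  X [fset phi u; phi v; phi w]%fset.
Proof. by move=> pc t; apply: chart_simplex (chart_tri pc t). Qed.

(** A retraction preserves types, hence sends positive steps to positive steps, and a shortest
    positive path from the origin maps to a positive path of the same length. *)
Lemma height_retract o phi psi r : typed_chart o phi -> typed_chart o psi ->
  (forall u, r (phi u) = u) -> (forall x, typ (phi (r x)) = typ x) ->
  (forall x y, X [fset x; y]%fset -> x <> y -> adj (r x) (r y)) ->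
  forall u, height (r (psi u)) <= height u.
Proof.
move=> [pc p0 pt] [qc q0 qt] rK rt radj.
have rcol u : colour (r (psi u)) = colour u.
  by have := rt (psi u); rewrite pt qt => /addrI.
move=> u; have [n] := ubnP (height u); elim: n u => // n IHn u hu.
have [->|/height_pred[w wu hw]] := eqVneq u 0%R.
  by rewrite -[0%R]/((0, 0)%R) q0 -p0 rK.
have awu : adj w u by rewrite /adj wu.
have [e1 e2] := chart_edge qc awu.
have ra := radj _ _ e1 e2.
have rw : height (r (psi w)) <= height w by apply: IHn; move: hu; rewrite hw; lia.
have : pos_step (r (psi w)) (r (psi u)).
  have := adj_colour ra; have := adj_colour awu; rewrite wu !rcol => ->.
  by case: ifP => // _ /addrI.
by move/height_pos_step/leq_trans; apply; rewrite hw ltnS.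
Qed.

(** The lower neighbours of [x] form a cone with apex [y0]. Each apartment through [o] and [x] has
    such a cone by [height_min]; the point is that the apex is the same for all of them. *)
Lemma morse_height o : exists h : V -> nat,
  [/\ h o = 0, forall x y, edge x y -> h x <> h y
    & forall x, x <> o -> exists y0, [/\ edge x y0, h y0 < h x
      & forall y, edge x y -> h y < h x -> y <> y0 -> X [fset x; y0; y]%fset]].
Proof.
have Xo x : X [fset x]%fset by case: X_complex.
have t0 : tri (0, 0)%R (1, 0)%R (0, 1)%R by vm_compute.
(* The height does not depend on the chart: retracting either apartment onto the other gives both
   inequalities. *)
have /choice[h hP] : forall x, exists n, forall phi u, typed_chart o phi ->
    phi u = x -> height u = n.
  move=> x; have [psi [qc _ px]] := typed_chart_cover (Xo o) (Xo x) (fset11 o).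
  have [|v vE] := in_chart_mem px (x := x); first by rewrite in_fset1.
  exists (height v) => phi u pc uE; apply/eqP; rewrite eqn_leq; apply/andP; split.
  - have [pc' _ _] := pc; have [r [rK rt ra _]] := retraction pc' t0.
    by have := height_retract pc qc rK rt ra v; rewrite vE -uE rK.
  - have [qc' _ _] := qc; have [r [rK rt ra _]] := retraction qc' t0.
    by have := height_retract qc pc rK rt ra u; rewrite uE -vE rK.
have hE phi u : typed_chart o phi -> h (phi u) = height u.
  by move=> pc; rewrite (hP _ _ _ pc erefl).
have edge_chart x y : edge x y -> exists phi u v,
    [/\ typed_chart o phi, phi u = x, phi v = y & adj u v].
  move=> [Xxy xy]; have [phi [tc _ ixy]] := typed_chart_cover (Xo o) Xxy (fset11 o).
  have [|u uE] := in_chart_mem ixy (x := x); first by rewrite !inE eqxx.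
  have [|v vE] := in_chart_mem ixy (x := y); first by rewrite !inE eqxx orbT.
  exists phi, u, v; split => //; have [pc _ _] := tc.
  case: (@in_chart_adj phi _ u v pc ixy) => //; rewrite ?uE ?vE ?inE ?eqxx ?orbT //.
  by move=> uv; case: xy; rewrite -uE -vE uv.
exists h; split=> [|x y /edge_chart[phi [u [v [tc <- <- uv]]]]|x xo].
- have [phi [tc _ _]] := typed_chart_cover (Xo o) (Xo o) (fset11 o).
  by have [_ p0 _] := tc; have := hE _ (0, 0)%R tc; rewrite p0.
- by rewrite !hE //; apply/eqP/height_neq.
have chart_min phi u : typed_chart o phi -> phi u = x -> u != 0%R.
  by move=> [_ p0 _] uE; apply/eqP => u0; apply: xo; rewrite -uE u0.
(* The apex is taken as a neighbour of [x] minimising [h] among all neighbours, whatever apartment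
   they lie in. *)
pose nbr n := `[< exists2 y, edge x y & h y = n >].
have nbr_ex : exists n, nbr n.
  have [phi [tc _ px]] := typed_chart_cover (Xo o) (Xo x) (fset11 o).
  have [|u uE] := in_chart_mem px (x := x); first by rewrite in_fset1.
  have [v [uv _ _ _]] := height_min (chart_min _ _ tc uE).
  have [pc _ _] := tc; exists (h (phi v)); apply/asboolP; exists (phi v) => //.
  by rewrite -uE; apply: chart_edge.
case: (ex_minnP nbr_ex) => n /asboolP[y0 xy0 hy0] minn.
(* Retract onto the given apartment, centred at a chamber on [u] and its local apex [v0]. The image
   of [y0] is a neighbour of [u] no higher than [v0], hence is [v0], and only [phi v0] retracts to a
   vertex of the centre so placed. *)
have y0E phi u : typed_chart o phi -> phi u = x -> exists v0,
    [/\ phi v0 = y0, adj u v0, height v0 < height u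
      & forall v, adj u v -> height v < height u -> v = v0 \/ tri u v0 v].
  move=> tc uE; have [pc _ _] := tc.
  have [v0 [uv0 lt0 min0 desc0]] := height_min (chart_min _ _ tc uE).
  exists v0; split => //; apply/esym.
  have [r [rK rt ra rc]] := retraction pc (tri_rot60 uv0).
  apply: rc; rewrite ?inE ?eqxx ?orbT //; apply: min0.
    by rewrite -(rK u) uE; case: xy0 => ? ?; apply: ra.
  have [psi [qc _ py]] := typed_chart_cover (Xo o) (Xo y0) (fset11 o).
  have [|w wE] := in_chart_mem py (x := y0); first by rewrite in_fset1.
  rewrite -{1}wE; apply: leq_trans (height_retract tc qc rK rt ra w) _.
  rewrite -(hE _ _ qc) wE hy0 -(hE _ _ tc); apply: minn; apply/asboolP.
  by exists (phi v0) => //; rewrite -uE; apply: chart_edge.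
exists y0; split => //.
  have [phi [tc _ px]] := typed_chart_cover (Xo o) (Xo x) (fset11 o).
  have [|u uE] := in_chart_mem px (x := x); first by rewrite in_fset1.
  by have [v0 [<- _ ? _]] := y0E _ _ tc uE; rewrite -uE !hE.
move=> y /edge_chart[phi [u [v [tc uE vE uv]]]] hyx yy0.
have [v0 [v0E _ _ desc0]] := y0E _ _ tc uE; have [pc _ _] := tc.
case: (desc0 v uv); first by rewrite -!(hE _ _ tc) uE vE.
  by move=> E; case: yy0; rewrite -vE E.
by rewrite -uE -v0E -vE; apply: chart_triangle.
Qed.

Lemma edge_connected o (P : V -> Prop) :
  P o -> (forall x y, edge x y -> P x -> P y) -> forall x, P x.
Proof.
move=> Po Pe x; have [h [_ _ hmin]] := morse_height o.
have [n] := ubnP (h x); elim: n x => // n IHn x hx.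
have [-> //|xo] := pselect (x = o).
have [y [xy yx _]] := hmin x xo.
by apply: Pe (edge_sym xy) _; apply: IHn; lia.
Qed.

(* This is the simple connectedness of the building: by induction on the height,
   the value at a vertex can be read off from any lower neighbour. *)
Lemma flat_cocycle_trivial (o : V) (H : groupType) (k : V -> V -> H) :
  (forall x y, edge x y -> k y x = (k x y)^-1) ->
  (forall x y z, edge x y -> edge y z -> edge x z -> X [fset x; y; z]%fset ->
     k x y * k y z = k x z) ->
  exists m : V -> H, forall x y, edge x y -> m y = m x * k x y.
Proof.
move=> kV kM; have [h [ho hneq hmin]] := morse_height o.
have /choice[p pP] : forall x, exists y0, x <> o ->
    [/\ edge x y0, h y0 < h x
      & forall y, edge x y -> h y < h x -> y <> y0 -> X [fset x; y0; y]%fset].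
  by move=> x; have [->|/hmin[y ?]] := pselect (x = o); [exists o|exists y].
(* The value is accumulated along the descending path of apexes; [n] is fuel, and any [n] above
   [h x] gives the same result. *)
pose fix M (n : nat) (x : V) {struct n} : H := if n is n'.+1 then
  if x == o then 1 else M n' (p x) * k (p x) x else 1.
have ME n n' x : h x < n -> h x < n' -> M n x = M n' x.
  elim: n n' x => // n IHn [//|n'] x hn hn' /=; case: eqP => // /pP[_ lt _].
  by rewrite (IHn n') //; lia.
pose m x := M (h x).+1 x.
have mE x : x <> o -> m x = m (p x) * k (p x) x.
  move=> xo; rewrite {1}/m /=; case: eqP => // _; congr (_ * _).
  by apply: ME => //; case: (pP x xo).
(* A lower neighbour [y] other than the apex [p x] spans a triangle with [x] and [p x]. Flatness
   there reduces the claim to the edge between [y] and [p x], both of which are lower than [x]. *)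
have descend n x y : h x < n -> edge x y -> h y < h x -> m x = m y * k y x.
  elim: n x y => // n IHn x y hx xy yx.
  have xo : x <> o by move=> E; move: yx; rewrite E ho.
  have [xp px xcone] := pP x xo; rewrite (mE x xo).
  have [-> //|yp] := pselect (y = p x).
  have Xxpy := xcone y xy yx yp.
  have py : edge (p x) y.
    split; last exact/nesym.
    by case: X_complex => _ _ H'; apply: H' Xxpy _; rewrite -fsetUA fsubsetUr.
  rewrite -(kM (p x) y x) ?mulgA //; [|exact: edge_sym|exact: edge_sym|].
  - congr (_ * _).
    have [lt|] := ltnP (h y) (h (p x)).
      rewrite (IHn (p x) y) //; last by lia.
      by rewrite (kV _ _ py) mulgVK.
    rewrite leq_eqVlt => /orP[/eqP/hneq//|lt].
    by rewrite (IHn y (p x)) //; [lia|exact: edge_sym].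
  - by rewrite fsetUC fsetUA.
exists m => x y xy; have [lt|] := ltnP (h x) (h y).
  by rewrite (descend (h y).+1 y x) //; apply: edge_sym.
rewrite leq_eqVlt => /orP[/eqP E|lt]; first by case: (hneq _ _ xy).
by rewrite (descend (h x).+1 x y) // (kV _ _ xy) mulgVK.
Qed.

(** * Edges, triangles and incidence in vertex links *)

Lemma sub_simplex s t : X s -> (t `<=` s)%fset -> X t.
Proof. by case: X_complex => _ _; apply. Qed.

Lemma typ_edge x y : X [fset x; y]%fset -> typ x <> typ y -> edge x y.
Proof. by move=> Xxy xy; split => // E; rewrite E in xy. Qed.

Lemma edge_typ x y : edge x y -> typ x <> typ y.
Proof. by move=> [Xxy xy] /(X_typ Xxy) E; apply: xy; apply: E; rewrite !inE eqxx ?orbT. Qed.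

Definition triangle x y z := [/\ X [fset x; y; z]%fset, edge x y, edge x z & edge y z].

Lemma triangle_intro x y z : X [fset x; y; z]%fset -> x <> y -> x <> z -> y <> z ->
  triangle x y z.
Proof.
move=> Xt xy xz yz; split=> //; split=> //; apply: (sub_simplex Xt).
- exact: fsubsetUl.
- by rewrite fsetUAC fsubsetUl.
- by rewrite -fsetUA fsubsetUr.
Qed.

Lemma triangle_typ x y z : X [fset x; y; z]%fset ->
  typ x <> typ y -> typ x <> typ z -> typ y <> typ z -> triangle x y z.
Proof.
by move=> Xt xy xz yz; apply: triangle_intro => // E; [apply: xy|apply: xz|apply: yz]; rewrite E.
Qed.

Lemma triangle_perm x y z : triangle x y z ->
  [/\ triangle x z y, triangle y x z & triangle z x y].
Proof.
move=> [Xt xy xz yz]; split; split => //; try exact: edge_sym.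
- by rewrite fsetUAC.
- by rewrite (fsetUC [fset y]%fset).
- by rewrite -fsetUA fsetUC.
Qed.

Lemma triangle_third_typ x y z i : triangle x y z -> i <> typ x -> i <> typ y ->
  i = typ z.
Proof.
move=> [_ /edge_typ xy /edge_typ xz /edge_typ yz] ix iy.
by apply: (ord3_third xy) => //; apply/nesym.
Qed.

Lemma edge_triangle x y : edge x y -> exists z, triangle x y z.
Proof.
move=> [Xxy xy]; have [phi [pc pxy _]] := chart_cover Xxy Xxy.
have [|u uE] := in_chart_mem pxy (x := x); first by rewrite !inE eqxx.
have [|v vE] := in_chart_mem pxy (x := y); first by rewrite !inE eqxx orbT.
have uv : adj u v.
  case: (@in_chart_adj phi _ u v pc pxy) => //; rewrite ?uE ?vE ?inE ?eqxx ?orbT //.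
  by move=> E; case: xy; rewrite -uE -vE E.
have t := tri_rot60 uv; exists (phi (rot60 u v)); case/and3P: (t) => _ uw vw.
by rewrite -uE -vE; split; [exact: chart_triangle|apply: chart_edge ..].
Qed.

Lemma vertex_edge x (i : 'I_3) : i <> typ x -> exists2 y, edge x y & typ y = i.
Proof.
move=> ix; have Xx : X [fset x]%fset by case: X_complex.
have [phi [[pc p0 pt] _ _]] := typed_chart_cover Xx Xx (fset11 x).
pose u : vertex := (1, 0)%R; pose v : vertex := (0, 1)%R.
have t : tri (0, 0)%R u v by vm_compute.
case/and3P: (t) => a1 a2 a3.
have T := chart_triangle pc t; rewrite p0 in T.
have xu := chart_edge pc a1; have xv := chart_edge pc a2; have uv := chart_edge pc a3.
rewrite p0 in xu xv.
have [iu|iu] := pselect (typ (phi u) = i); first by exists (phi u).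
exists (phi v) => //; apply: (ord3_third (edge_typ xu)).
- exact/nesym/edge_typ.
- exact/nesym/edge_typ.
- by [].
- exact/nesym.
Qed.

(** Uniqueness of joining lines. A retraction centred at the chamber [x], [p], [l] maps the square
    into a hexagon, where it degenerates, and only [p] and [l] themselves retract to the images of
    [p] and [l]. *)
Lemma link_no_square x p p' l l' : triangle x p l -> triangle x p' l' ->
  edge p l' -> edge p' l -> p <> p' -> l = l'.
Proof.
move=> [Xt [xp1 xp2] [xl1 xl2] [pl1 pl2]] [_ [xp'1 xp'2] [xl'1 xl'2] [pl'1 pl'2]].
move=> [e1 e2] [e3 e4] pp'.
have [phi [pc ipl _]] := chart_cover Xt Xt.
have [|o oE] := in_chart_mem ipl (x := x); first by rewrite !inE eqxx.
have [|a aE] := in_chart_mem ipl (x := p); first by rewrite !inE eqxx ?orbT.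
have [|b bE] := in_chart_mem ipl (x := l); first by rewrite !inE eqxx ?orbT.
have t : tri o a b.
  apply: (in_chart_tri pc); rewrite ?oE ?aE ?bE // => E.
  - by case: xp2; rewrite -oE -aE E.
  - by case: xl2; rewrite -oE -bE E.
  - by case: pl2; rewrite -aE -bE E.
have [r [rK _ ra rc]] := retraction pc t.
have ro : r x = o by rewrite -oE rK.
have rp : r p = a by rewrite -aE rK.
have rl : r l = b by rewrite -bE rK.
have au := ra _ _ xp'1 xp'2; have aw := ra _ _ xl'1 xl'2; have uw := ra _ _ pl'1 pl'2.
have pw := ra _ _ e1 e2; have ul := ra _ _ e3 e4.
rewrite ?ro ?rp ?rl in au aw uw pw ul.
case: (hexagon_no_square t au aw uw pw ul) => E.
  by case: pp'; rewrite -aE; apply/esym/rc; rewrite // !inE eqxx orbT.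
by rewrite -bE; apply/esym/rc; rewrite // !inE eqxx !orbT.
Qed.

(** Existence of joining lines, found in the hexagon around [x] in an apartment containing both
    edges. *)
Lemma link_common_neighbour x p p' : edge x p -> edge x p' -> typ p = typ p' ->
  p <> p' -> exists l, triangle x p l /\ triangle x p' l.
Proof.
move=> [xp1 xp2] [xp'1 xp'2] tpp' pp'.
have [|phi [[pc p0 pt] ip ip']] := typed_chart_cover (o := x) xp1 xp'1; first by rewrite !inE eqxx.
have [|a aE] := in_chart_mem ip (x := p); first by rewrite !inE eqxx ?orbT.
have [|a' a'E] := in_chart_mem ip' (x := p'); first by rewrite !inE eqxx ?orbT.
have a0 : adj (0, 0)%R a.
  case: (@in_chart_adj phi _ (0, 0)%R a pc ip); rewrite ?p0 ?aE ?inE ?eqxx ?orbT //.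
  by move=> E; case: xp2; rewrite -aE -E.
have a'0 : adj (0, 0)%R a'.
  case: (@in_chart_adj phi _ (0, 0)%R a' pc ip'); rewrite ?p0 ?a'E ?inE ?eqxx ?orbT //.
  by move=> E; case: xp'2; rewrite -a'E -E.
have aa' : a <> a' by move=> E; case: pp'; rewrite -aE -a'E E.
have ca : colour a = colour a' by move: tpp'; rewrite -aE -a'E !pt => /addrI.
have [b [t t']] := hexagon_common_neighbour a0 a'0 aa' ca.
have T u v w : tri u v w -> triangle (phi u) (phi v) (phi w).
  move=> tt; have := chart_triangle pc tt; case/and3P: tt => ? ? ?.
  by split => //; apply: chart_edge.
by exists (phi b); split; rewrite -?aE -?a'E -p0; apply: T.
Qed.

Section Order.
Variable q : nat.
Hypothesis X_thick : thick X.
Hypothesis X_order : forall p, panels X p -> chambers_on X p #= `I_q.+1.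

Lemma edge_panel x y : edge x y -> panels X [fset x; y]%fset.
Proof. by move=> [Xxy xy]; split; rewrite // cardfs2; case: eqP. Qed.

Lemma edge_order x y : edge x y -> [set z | triangle x y z] #= `I_q.+1.
Proof.
move=> xy; apply: card_eq_trans (X_order (edge_panel xy)).
rewrite card_eq_sym.
have -> : chambers_on X [fset x; y]%fset =
  (fun z => [fset x; y; z]%fset) @` [set z | triangle x y z].
  apply/seteqP; split=> c /=.
    move=> [[Xc c3] xyc].
    have : #|` (c `\` [fset x; y])%fset| = 1%N.
      have := cardfsID [fset x; y]%fset c; rewrite c3 fsetIC (fsetIidPl xyc).
      by case: (edge_panel xy) => _ ->; lia.
    move=> /eqP/cardfs1P[z zE]; exists z.
      have zc : [fset x; y; z]%fset = c by rewrite -zE -[RHS](fsetID [fset x; y]%fset) fsetIC (fsetIidPl xyc).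
      have : z \notin [fset x; y]%fset.
        have : z \in [fset z]%fset by rewrite in_fset1.
        by rewrite -zE in_fsetD => /andP[].
      rewrite !inE negb_or => /andP[/eqP zx /eqP zy] //.
      by apply: triangle_intro; rewrite ?zc //; [case: xy|apply/nesym|apply/nesym].
    by rewrite -zE -[RHS](fsetID [fset x; y]%fset) fsetIC (fsetIidPl xyc).
  case=> z [Xt [_ /eqP xy'] [_ /eqP xz] [_ /eqP yz]] <-.
  split; last exact: fsubsetUl; split => //.
  by rewrite fsetUC cardfsU1 cardfs2 xy' !inE negb_or !(eq_sym z) xz yz.
apply: inj_card_eq => z w; rewrite !inE => -[_ _ [_ xz] [_ yz]] _ E.
have : z \in [fset x; y; w]%fset by rewrite -E !inE eqxx orbT.
by rewrite !inE => /orP[/orP[/eqP Ez|/eqP Ez]|/eqP //]; [case: xz|case: yz].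
Qed.

Lemma order_ge2 x y : edge x y -> 2 <= q.
Proof.
move=> xy; have := X_thick (edge_panel xy).
by rewrite (card_le_eqr (X_order (edge_panel xy))) card_le_II.
Qed.

(** Thickness gives at least three triangles on every edge, so two vertices can be avoided. *)
Lemma edge_third x y z z' : edge x y -> exists w, [/\ triangle x y w, w <> z & w <> z'].
Proof.
move=> xy; have C := card_fset_set (edge_order xy).
have fin : finite_set [set w | triangle x y w].
  by apply/finite_setP; exists q.+1; apply: edge_order.
apply: contrapT => H.
have : (fset_set [set w | triangle x y w] `<=` [fset z; z'])%fset.
  apply/fsubsetP=> w; rewrite in_fset_set // inE => t; rewrite !inE.
  by case: eqP => //= wz; case: eqP => //= wz'; case: H; exists w.
move=> /fsubset_leq_card; rewrite C cardfs2.
by have := order_ge2 xy; case: (z != z'); lia.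
Qed.
End Order.

Lemma ord3_neq (i : 'I_3) : [/\ ordS i <> i, ord_pred i <> i & ordS i <> ord_pred i].
Proof. by case: i => -[|[|[|//]]] ?; split=> /(congr1 val). Qed.

Lemma link_join x (i j : 'I_3) p p' : i <> j -> i <> typ x -> j <> typ x ->
  edge x p -> edge x p' -> typ p = i -> typ p' = i -> p <> p' ->
  exists! l, [/\ typ l = j, triangle x p l & triangle x p' l].
Proof.
move=> ij ix jx xp xp' tp tp' pp'.
have [l [t t']] := link_common_neighbour xp xp' (etrans tp (esym tp')) pp'.
exists l; split.
  by split => //; apply/esym/(triangle_third_typ t) => //; rewrite tp; apply/nesym.
move=> l' [_ [_ _ _ pl'] t'l']; have [_ _ _ p'l'] := t'l'.
by case: (t') => _ _ _ p'l; apply: (link_no_square t t'l').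
Qed.

(** * Vertex links are projective planes of order [q] *)

Section LinkPlane.
Variable q : nat.
Hypothesis X_thick : thick X.
Hypothesis X_order : forall p, panels X p -> chambers_on X p #= `I_q.+1.
Variable v : V.
Let E := link_plane X typ v.

Lemma link_point p : points E p <-> edge v p /\ typ p = ord_pred (typ v).
Proof.
have [_ n _] := ord3_neq (typ v).
split=> [[Xp tp]|[[Xp _] tp]] //; split => //; apply: typ_edge => //; rewrite tp.
exact/nesym.
Qed.

Lemma link_line l : lines E l <-> edge v l /\ typ l = ordS (typ v).
Proof.
have [n _ _] := ord3_neq (typ v).
split=> [[Xp tp]|[[Xp _] tp]] //; split => //; apply: typ_edge => //; rewrite tp.
exact/nesym.
Qed.

Lemma link_incident p l : points E p -> lines E l -> incident E p l <-> triangle v p l.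
Proof.
have [n1 n2 n3] := ord3_neq (typ v).
move=> /link_point[/edge_typ vp tp] /link_line[/edge_typ vl tl].
split=> [Xt|[]] //; apply: triangle_typ => //; rewrite tp tl; exact/nesym.
Qed.

Lemma triangle_point p l : lines E l -> triangle v p l -> points E p.
Proof.
have [n1 n2 n3] := ord3_neq (typ v).
move=> /link_line[_ tl] [_ vp vl pl]; apply/link_point; split => //.
apply: (@ord3_third (typ v) (ordS (typ v))); try exact/nesym; try done.
  exact/nesym/edge_typ.
by rewrite -tl; apply: edge_typ.
Qed.

Lemma triangle_line p l : points E p -> triangle v p l -> lines E l.
Proof.
have [n1 n2 n3] := ord3_neq (typ v).
move=> /link_point[_ tp] [_ vp vl pl]; apply/link_line; split => //.
apply: (@ord3_third (typ v) (ord_pred (typ v))); try exact/nesym; try done.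
  exact/nesym/edge_typ.
by rewrite -tp; apply/nesym/edge_typ.
Qed.

Lemma triangle_swap p l : triangle v p l <-> triangle v l p.
Proof. by split=> /triangle_perm[]. Qed.

Lemma link_point_join p p' : points E p -> points E p' -> p <> p' ->
  exists! l, [/\ lines E l, triangle v p l & triangle v p' l].
Proof.
have [n1 n2 n3] := ord3_neq (typ v).
move=> Pp Pp' pp'; have [vp tp] := (link_point p).1 Pp; have [vp' tp'] := (link_point p').1 Pp'.
have [l [[tl t t'] uniq]] := link_join (nesym n3) n2 n1 vp vp' tp tp' pp'.
exists l; split; first by split => //; apply: triangle_line t.
by move=> l' [/link_line[_ ?] ? ?]; apply: uniq.
Qed.

Lemma link_line_join l l' : lines E l -> lines E l' -> l <> l' ->
  exists! p, [/\ points E p, triangle v p l & triangle v p l'].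
Proof.
have [n1 n2 n3] := ord3_neq (typ v).
move=> Ll Ll' ll'; have [vl tl] := (link_line l).1 Ll; have [vl' tl'] := (link_line l').1 Ll'.
have [p [[tp t t'] uniq]] := link_join n3 n1 n2 vl vl' tl tl' ll'.
have tpl := (triangle_swap l p).1 t; have tpl' := (triangle_swap l' p).1 t'.
exists p; split; first by split => //; apply: triangle_point tpl.
by move=> p' [/link_point[_ ?] /triangle_swap ? /triangle_swap ?]; apply: uniq.
Qed.

Lemma link_unique p p' l l' : points E p -> points E p' -> p <> p' ->
  triangle v p l -> triangle v p' l -> triangle v p l' -> triangle v p' l' -> l = l'.
Proof.
move=> Pp Pp' pp' t1 t2 t3 t4; have [l0 [_ uniq]] := link_point_join Pp Pp' pp'.
by rewrite -(uniq l) ?(uniq l') //; split => //; [apply: triangle_line t3|apply: triangle_line t1].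
Qed.

(** Take three lines [l12], [l13], [m] through a point [p1], then further points [p2], [p3] on the
    first two, and on [m] a point [p4] that avoids [p1] and the line joining [p2] and [p3]. *)
Lemma link_quadrangle : exists p : 'I_4 -> V,
  [/\ injective p, forall i, points E (p i)
    & forall l i j k, lines E l -> i <> j -> j <> k -> i <> k ->
        ~ [/\ incident E (p i) l, incident E (p j) l & incident E (p k) l]].
Proof.
have [n1 n2 n3] := ord3_neq (typ v).
have third := edge_third X_thick X_order.
have [p1 vp1 tp1] := vertex_edge n2.
have P1 : points E p1 by apply/link_point.
have [l12 t12] := edge_triangle vp1.
have [l13 [t13 l13n _]] := third _ _ l12 l12 vp1.
have [m [tm m12 m13]] := third _ _ l12 l13 vp1.
have [_ _ vl12 _] := t12; have [_ _ vl13 _] := t13; have [_ _ vm _] := tm.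
have [p2 [/triangle_swap t2 p21 _]] := third _ _ p1 p1 vl12.
have [p3 [/triangle_swap t3 p31 _]] := third _ _ p1 p1 vl13.
have L12 := triangle_line P1 t12; have L13 := triangle_line P1 t13.
have Lm := triangle_line P1 tm.
have P2 := triangle_point L12 t2; have P3 := triangle_point L13 t3.
have p13n : ~ triangle v p3 l12.
  by move=> t; apply: l13n; apply: (link_unique P1 P3) => //; apply/nesym.
have p23 : p2 <> p3 by move=> e; apply: p13n; rewrite -e.
have [l23 [[L23 t23 t32] _]] := link_point_join P2 P3 p23.
have mn : m <> l23.
  by move=> e; apply: m12; apply: (link_unique P1 P2) => //; [apply/nesym|rewrite e].
(* [x] is the one point of [m] that would make [p2], [p3], [p4] collinear. *)
have [x [[Px txm tx23] _]] := link_line_join Lm L23 mn.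
have [p4 [/triangle_swap t4 p41 p4x]] := third _ _ p1 x vm.
have P4 := triangle_point Lm t4.
have p4_12 : ~ triangle v p4 l12.
  by move=> t; apply: m12; apply: (link_unique P1 P4) => //; apply/nesym.
have p4_13 : ~ triangle v p4 l13.
  by move=> t; apply: m13; apply: (link_unique P1 P4) => //; apply/nesym.
have p4_23 : ~ triangle v p4 l23.
  by move=> t; apply: mn; apply: (link_unique Px P4) => //; apply/nesym.
have p42 : p4 <> p2 by move=> e; apply: p4_12; rewrite e.
have p43 : p4 <> p3 by move=> e; apply: p4_13; rewrite e.
have c123 l : triangle v p1 l -> triangle v p2 l -> triangle v p3 l -> False.
  move=> a1 a2 a3; apply: p13n; rewrite (@link_unique p1 p2 l12 l) //; exact/nesym.
have c124 l : triangle v p1 l -> triangle v p2 l -> triangle v p4 l -> False.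
  move=> a1 a2 a3; apply: p4_12; rewrite (@link_unique p1 p2 l12 l) //; exact/nesym.
have c134 l : triangle v p1 l -> triangle v p3 l -> triangle v p4 l -> False.
  move=> a1 a2 a3; apply: p4_13; rewrite (@link_unique p1 p3 l13 l) //; exact/nesym.
have c234 l : triangle v p2 l -> triangle v p3 l -> triangle v p4 l -> False.
  by move=> a1 a2 a3; apply: p4_23; rewrite (@link_unique p2 p3 l23 l).
pose p (i : 'I_4) := nth v [:: p1; p2; p3; p4] i.
have pP i : points E (p i) by case: i => -[|[|[|[|//]]]] ?.
exists p; split => //.
  move=> [[|[|[|[|//]]]] ?] [[|[|[|[|//]]]] ?] => // e; first [exact: val_inj | exfalso];
    by [move/esym: e | move: e].
move=> l i j k Ll ij jk ik [/(link_incident (pP i) Ll) + /(link_incident (pP j) Ll) +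
  /(link_incident (pP k) Ll)]; move: ij jk ik.
case: i => -[|[|[|[|//]]]] ?; case: j => -[|[|[|[|//]]]] ?; case: k => -[|[|[|[|//]]]] ?;
  rewrite /p /= => ij jk ik; try (by case: ij; apply: val_inj);
  try (by case: jk; apply: val_inj); try (by case: ik; apply: val_inj); eauto.
Qed.

Lemma link_projective : projective_plane E.
Proof.
split; last exact: link_quadrangle.
- move=> p p' Pp Pp' pp'; have [l [[Ll t t'] uniq]] := link_point_join Pp Pp' pp'.
  exists l; split; first by split => //; apply/link_incident.
  by move=> l' [Ll' /link_incident i /link_incident i']; apply: uniq; split; auto.
- move=> l l' Ll Ll' ll'; have [p [[Pp t t'] uniq]] := link_line_join Ll Ll' ll'.
  exists p; split; first by split => //; apply/link_incident.
  by move=> p' [Pp' /link_incident i /link_incident i']; apply: uniq; split; auto.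
Qed.

Lemma link_order : plane_order E q.
Proof.
move=> l Ll; have [vl _] := (link_line l).1 Ll.
rewrite (_ : [set p | _] = [set p | triangle v l p]); first exact: edge_order.
apply/seteqP; split=> p /=; first by move=> [Pp /link_incident]/(_ Pp Ll)/triangle_swap.
move=> /triangle_swap t; have Pp := triangle_point Ll t.
by split => //; apply/link_incident.
Qed.
End LinkPlane.
End Charts.

(** * Regular actions on finite planes *)

Section FreeActions.
Variables (S : groupType) (T : choiceType) (b : gaction S T).

Lemma gactK s : cancel (b s) (b s^-1).
Proof. by move=> x; rewrite -gactM mulVg gact1. Qed.

Lemma gactVK s : cancel (b s^-1) (b s).
Proof. by move=> x; rewrite -gactM mulgV gact1. Qed.

Lemma gact_inj s : injective (b s).
Proof. exact: can_inj (gactK s). Qed.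

(** Every orbit has as many elements as [H]; the induction removes one orbit at a time. *)
Lemma card_free_action (H : {fset S}) (A : {fset T}) :
  1 \in H -> {in H &, forall s t, s * t \in H} -> {in H, forall s, s^-1 \in H} ->
  {in H & A, forall s x, b s x \in A} ->
  {in H & A, forall s x, b s x = x -> s = 1} ->
  #|` H| %| #|` A|.
Proof.
move=> H1 HM HV; have [n] := ubnP #|` A|; elim: n A => // n IHn A An HA Hfree.
have [->|[x xA]] := fset_0Vmem A; first by rewrite cardfs0 dvdn0.
pose O := [fset b s x | s in H]%fset.
have O_A : (O `<=` A)%fset by apply/fsubsetP=> _ /imfsetP[s sH ->]; apply: HA.
have cardO : #|` O| = #|` H|.
  apply: card_in_imfset => s t sH tH E; rewrite -[t](mulVKg s).
  rewrite (Hfree (s^-1 * t) x) ?mulg1 //; first by rewrite HM // HV.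
  by rewrite gactM -E gactK.
have := cardfsID O A; rewrite (fsetIidPr O_A) cardO => <-.
rewrite dvdn_addr //; apply: IHn.
- have : x \in O by apply/imfsetP; exists 1; rewrite ?gact1.
  have := cardfsID O A; rewrite (fsetIidPr O_A).
  move=> cA xO; have : 0 < #|` O| by rewrite cardfs_gt0; apply/fset0Pn; exists x.
  by move: An cA; lia.
- move=> s y sH; rewrite !in_fsetD => /andP[yO yA]; rewrite HA // andbT.
  apply: contra yO => /imfsetP[t tH E]; apply/imfsetP; exists (s^-1 * t).
    by rewrite HM // HV.
  by rewrite gactM -E gactK.
- by move=> s y sH; rewrite in_fsetD => /andP[_ yA]; apply: Hfree.
Qed.
End FreeActions.

Section FinitePlanes.
Variables (T : choiceType) (q : nat).

(* The pencil of lines through [p0] partitions the points other than [p0]. *)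
Lemma card_plane (inc : rel T) (P L : {fset T}) p0 :
  {in P &, forall p p', p <> p' ->
     exists! l, [/\ l \in L, inc p l & inc p' l]} ->
  {in L, forall l, #|` [fset p in P | inc p l]%fset| = q.+1} ->
  {in P, forall p, #|` [fset l in L | inc p l]%fset| = q.+1} ->
  p0 \in P -> #|` P| = (q.+1 * q).+1.
Proof.
move=> join cardL cardP p0P; rewrite (cardfsD1 p0) p0P add1n; congr _.+1.
pose L0 := [fset l in L | inc p0 l]%fset.
have count1 (A : {fset T}) (a : pred T) :
    \sum_(x <- A) (a x : nat) = #|` [fset x in A | a x]%fset|.
  rewrite card_fset_sum1 -big_fset_condE /= [RHS]big_mkcond.
  by apply: eq_bigr => x _; case: (a x).
rewrite card_fset_sum1.
transitivity (\sum_(p <- (P `\ p0)%fset) \sum_(l <- L0) (inc p l : nat)).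
  apply: eq_big_seq => p; rewrite in_fsetD1 => /andP[/eqP pp0 pP].
  have [l [[lL p0l pl] uniq]] := join p0 p p0P pP (nesym pp0).
  rewrite count1 (_ : [fset _ in _ | _]%fset = [fset l]%fset) ?cardfs1 //.
  apply/fsetP=> l'; rewrite !inE; apply/andP/eqP => [[/andP[l'L p0l'] pl']|->].
    by rewrite (uniq l').
  by rewrite lL p0l pl.
rewrite exchange_big /= (eq_big_seq (fun=> q)) => [|l].
  by rewrite big_const_seq count_predT iter_addn_0 (cardP _ p0P) mulnC.
rewrite !inE => /andP[lL p0l]; rewrite count1.
have := cardL l lL; rewrite (cardfsD1 p0) !inE p0P p0l add1n => -[<-].
by congr #|` _|; apply/fsetP=> p; rewrite !inE andbA.
Qed.

(** The stabiliser of a point acts freely on lines, so its order divides both the number of all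
    lines and the number [q.+1] of lines through the point. These are coprime, which gives freeness
    on points; transitivity follows by counting. *)
Lemma regular_on_points (S : groupType) (b : gaction S T) (inc : rel T)
    (P L : {fset T}) :
  {in P &, forall p p', p <> p' ->
     exists! l, [/\ l \in L, inc p l & inc p' l]} ->
  {in L &, forall l l', l <> l' ->
     exists! p, [/\ p \in P, inc p l & inc p l']} ->
  {in L, forall l, #|` [fset p in P | inc p l]%fset| = q.+1} ->
  {in P, forall p, #|` [fset l in L | inc p l]%fset| = q.+1} ->
  (forall s, {in P, forall p, b s p \in P}) ->
  (forall s, {in L, forall l, b s l \in L}) ->
  (forall s, {in P & L, forall p l, inc (b s p) (b s l) = inc p l}) ->
  {in L &, forall l l', exists s, b s l = l'} ->
  (forall s, {in L, forall l, b s l = l -> s = 1}) ->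
  {in P &, forall p p', exists s, b s p = p'} /\
  (forall s, {in P, forall p, b s p = p -> s = 1}).
Proof.
move=> joinP joinL cardL cardP bP bL binc trans free.
suff main p : p \in P -> {in P, forall p', exists s, b s p = p'} /\
    (forall s, b s p = p -> s = 1).
  by split=> [p p' pP p'P|s p pP]; [case: (main p pP) => + _; apply|case: (main p pP) => _; apply].
move=> pP.
have [l0 l0L] : exists l, l \in L.
  have : 0 < #|` [fset l in L | inc p l]%fset| by rewrite cardP.
  by rewrite cardfs_gt0 => /fset0Pn[l]; rewrite !inE => /andP[]; exists l.
have /choice[g gE] : forall l, exists s, l \in L -> b s l0 = l.
  by move=> l; have [/(trans _ _ l0L)[s ?]|_] := boolP (l \in L); [exists s|exists 1].
(* By regularity on the finite set of lines, [F] contains every element of the group. *)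
pose F := [fset g l | l in L]%fset.
have FT s : s \in F.
  apply/imfsetP; exists (b s l0) => /=; first exact: bL.
  rewrite -[LHS](mulVKg (g (b s l0))).
  rewrite (free ((g (b s l0))^-1 * s) l0) ?mulg1 // gactM.
  by have e := gE _ (bL s _ l0L); rewrite -[X in b _ X = _]e gactK.
have cardPE : #|` P| = (q.+1 * q).+1 by apply: (@card_plane inc P L p).
have cardLE : #|` L| = (q.+1 * q).+1.
  by apply: (@card_plane (fun l p => inc p l) L P l0).
have cardF : #|` F| = (q.+1 * q).+1.
  rewrite -cardLE; apply: card_in_imfset => l l' lL l'L E.
  by rewrite -(gE l lL) E gE.
pose H := [fset s in F | b s p == p]%fset.
have HE s : (s \in H) = (b s p == p) by rewrite !inE FT.
have H1 : 1 \in H by rewrite HE gact1.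
have dvdH (A : {fset T}) : (A `<=` L)%fset ->
    (forall s x, s \in H -> x \in A -> b s x \in A) -> #|` H| %| #|` A|.
  move=> AL HA; apply: (@card_free_action _ _ b) => //.
  - by move=> s t; rewrite !HE gactM => /eqP sp /eqP tp; rewrite tp sp.
  - by move=> s; rewrite !HE => /eqP sp; rewrite -{1}sp gactK.
  - by move=> s x _ /(fsubsetP AL) xL; apply: free.
have d1 : #|` H| %| (q.+1 * q).+1.
  by rewrite -cardLE; apply: dvdH => // s x _; apply: bL.
have d2 : #|` H| %| q.+1.
  rewrite -(cardP p pP); apply: dvdH => [|s x].
    by apply/fsubsetP=> l; rewrite !inE => /andP[].
  rewrite HE !inE => /eqP sp /andP[xL px].
  by rewrite bL //= -[X in inc X]sp binc.
(* A divisor of [q.+1] that also divides [(q.+1 * q).+1] divides 1. *)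
have cardH : #|` H| = 1%N.
  apply/eqP; rewrite -dvdn1; move: d1; rewrite -addn1 dvdn_addr //.
  exact: dvdn_mulr.
have fixed s : b s p = p -> s = 1.
  move=> sp; move/eqP/cardfs1P: cardH => [x Hx].
  have : s \in H by rewrite HE sp.
  by move: H1; rewrite Hx !inE => /eqP -> /eqP.
split=> // p' p'P.
(* The orbit of [p] is as large as the group, hence as large as the set of points. *)
have sub : ([fset b s p | s in F] `<=` P)%fset.
  by apply/fsubsetP=> _ /imfsetP[s _ ->]; apply: bP.
have cardI : #|` [fset b s p | s in F]%fset| = #|` P|.
  rewrite cardPE -cardF; apply: card_in_imfset => s t _ _ E.
  by rewrite -[t](mulVKg s) (fixed (s^-1 * t)) ?mulg1 // gactM -E gactK.
by move/(fsubset_cardP cardI)/(_ p'): sub; rewrite p'P => /imfsetP[s _ ->]; exists s.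
Qed.
End FinitePlanes.

Lemma stabilizer_fix (G : groupType) (T : Type) (a : gaction G T) x
  (s : stabilizer a x) : a (val s) x = x.
Proof. exact/asboolP/stabilizerP. Qed.

(** * Passing regularity from one panel type to the others *)

Section PanelRegularity.
Variables (V : choiceType) (X : set {fset V}) (typ : V -> 'I_3).
Variables (As : set (set {fset V})) (q : nat).
Hypotheses (Xc : simplicial_complex X) (Xa : apartment_system X As).
Hypotheses (Xt : colouring X typ) (Xf : locally_finite X).
Hypothesis Xo : forall p, panels X p -> chambers_on X p #= `I_q.+1.
Variables (G : groupType) (a : gaction G V).
Hypotheses (a_aut : acts_by_automorphisms X a).
Hypotheses (a_typ : forall g v, typ (a g v) = typ v).
Implicit Types (x y z : V) (i k l : 'I_3).

Lemma act_edge g x y : edge X (a g x) (a g y) <-> edge X x y.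
Proof.
rewrite /edge -fimage2; have [_ /(_ [fset x; y]%fset) XE] := a_aut g.
split=> -[/XE Xxy xy]; split=> // E; apply: xy; first by rewrite E.
exact: gact_inj E.
Qed.

Lemma act_triangle g x y z : triangle X (a g x) (a g y) (a g z) <-> triangle X x y z.
Proof.
rewrite /triangle -fimage3; have [_ /(_ [fset x; y; z]%fset) XE] := a_aut g.
by split=> -[/XE ? /act_edge ? /act_edge ? /act_edge ?]; split.
Qed.

Definition regular_on_edges i k :=
  (forall x y x' y', edge X x y -> edge X x' y' -> typ x = i -> typ x' = i ->
     typ y = k -> typ y' = k -> exists g, a g x = x' /\ a g y = y') /\
  (forall g x y, edge X x y -> typ x = i -> typ y = k ->
     a g x = x -> a g y = y -> g = 1).

Lemma panel_of_type i k p : panels_of_type X typ [fset i; k]%fset p -> i <> k ->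
  exists x y, [/\ p = [fset x; y]%fset, edge X x y, typ x = i & typ y = k].
Proof.
move=> [[Xp p2] pT] ik.
have /fimageP[x xp xi] : i \in fimage typ p by rewrite pT !inE eqxx.
have /fimageP[y yp yk] : k \in fimage typ p by rewrite pT !inE eqxx orbT.
have xy : x <> y by move=> E; apply: ik; rewrite xi yk E.
have pE : p = [fset x; y]%fset.
  apply/esym/eqP; rewrite eqEfcard p2 cardfs2; case: eqP => //= _; rewrite andbT.
  by apply/fsubsetP=> z; rewrite !inE => /orP[]/eqP->.
by exists x, y; split=> //; rewrite pE in Xp.
Qed.

Lemma edge_panel_of_type x y :
  edge X x y -> panels_of_type X typ [fset typ x; typ y]%fset [fset x; y]%fset.
Proof. by move=> xy; split; [exact: edge_panel|rewrite fimage2]. Qed.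

Lemma act_pair g x y x' y' : edge X x y -> typ x = typ x' -> typ y = typ y' ->
  fimage (a g) [fset x; y]%fset = [fset x'; y']%fset -> a g x = x' /\ a g y = y'.
Proof.
move=> xy tx ty; rewrite fimage2 => E.
have txy := edge_typ Xt xy.
have : a g x \in [fset x'; y']%fset by rewrite -E !inE eqxx.
have : a g y \in [fset x'; y']%fset by rewrite -E !inE eqxx orbT.
rewrite !inE => /orP[]/eqP Ey; first by case: txy; rewrite tx -Ey a_typ.
by case/orP=> /eqP Ex //; case: txy; rewrite ty -Ex a_typ.
Qed.

(** The two ends of a panel have different types and types are preserved, so an element moving one
    panel to another moves its ends accordingly, and panels may be treated as ordered edges. *)
Lemma regular_on_panelsP i k : i <> k ->
  acts_regularly_on (set_action a) (panels_of_type X typ [fset i; k]%fset) <->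
  regular_on_edges i k.
Proof.
move=> ik; split=> -[trans free]; split.
- move=> x y x' y' xy xy' tx tx' ty ty'.
  have := edge_panel_of_type xy; have := edge_panel_of_type xy'.
  rewrite tx tx' ty ty' => p' p; have [g /act_pair E] := trans _ _ p p'.
  by exists g; apply: E; rewrite ?tx ?ty.
- move=> g x y xy tx ty gx gy; have := edge_panel_of_type xy.
  rewrite tx ty => p; apply: (free g _ p).
  by rewrite /set_action /= fimage2 gx gy.
- move=> p p' /panel_of_type/(_ ik)[x [y [-> xy tx ty]]].
  move=> /panel_of_type/(_ ik)[x' [y' [-> xy' tx' ty']]].
  have [g [gx gy]] := trans _ _ _ _ xy xy' tx tx' ty ty'.
  by exists g; rewrite /set_action /= fimage2 gx gy.
- move=> g p /panel_of_type/(_ ik)[x [y [-> xy tx ty]]].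
  by move=> /(act_pair xy erefl erefl)[gx gy]; apply: (free g x y).
Qed.

Lemma regular_on_edges_sym i k : regular_on_edges i k -> regular_on_edges k i.
Proof.
move=> [trans free]; split.
  move=> x y x' y' /edge_sym xy /edge_sym xy' tx tx' ty ty'.
  by have [g [gx gy]] := trans _ _ _ _ xy xy' ty ty' tx tx'; exists g.
by move=> g x y /edge_sym xy tx ty gx gy; apply: (free g y x).
Qed.

Lemma finite_neighbours x i :
  exists N : {fset V}, forall z, z \in N <-> edge X x z /\ typ z = i.
Proof.
pose F := fset_set [set s | X s /\ x \in s].
exists [fset z in \bigcup_(s <- F) s | `[< edge X x z /\ typ z = i >]]%fset => z.
rewrite !inE /=; split=> [/andP[_ /asboolP]//|H]; apply/andP; split; last exact/asboolP.
apply/bigfcupP; exists [fset x; z]%fset; last by rewrite !inE eqxx orbT.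
rewrite andbT in_fset_set ?inE; last exact: Xf.
by split; [case: H => -[]|rewrite !inE eqxx].
Qed.

(** In the link of a vertex of type [i], its stabiliser is regular on neighbours of type [k], hence
    by [regular_on_points] on those of type [l]. *)
Lemma regular_on_edges_third i k l : i <> k -> l <> i -> l <> k ->
  regular_on_edges i k -> regular_on_edges i l.
Proof.
move=> ik li lk [trans free].
have main x : typ x = i ->
    (forall y y', edge X x y -> edge X x y' -> typ y = l -> typ y' = l ->
       exists g, a g x = x /\ a g y = y') /\
    (forall g y, edge X x y -> typ y = l -> a g x = x -> a g y = y -> g = 1).
  move=> tx; have [P PP] := finite_neighbours x l; have [L LP] := finite_neighbours x k.
  pose inc : rel V := fun p m => `[< triangle X x p m >].
  (* Used for both kinds of elements of the link: points on a line and lines through a point. *)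
  have pencil p (A : {fset V}) j : edge X x p -> typ p <> j -> j <> i ->
      (forall z, z \in A <-> edge X x z /\ typ z = j) ->
      #|` [fset m in A | `[< triangle X x p m >]]%fset| = q.+1.
    move=> xp pj ji AP; apply/card_eq_fsetP.
    rewrite (_ : [set` _] = [set m | triangle X x p m]); first exact: (edge_order Xc Xo).
    apply/seteqP; split=> m /=; rewrite !inE; first by move=> /andP[_ /asboolP].
    move=> t; apply/andP; split; last exact/asboolP.
    apply/AP; have [_ _ xm pm] := t; split => //.
    by apply/esym/(triangle_third_typ Xt t); [rewrite tx|apply/nesym].
  have [tr fr] : {in P &, forall p p', exists s, stabilizer_action a x s p = p'} /\
      (forall s, {in P, forall p, stabilizer_action a x s p = p -> s = 1}).
    apply: (@regular_on_points V q _ (stabilizer_action a x) inc P L).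
    - move=> p p' /PP[xp tp] /PP[xp' tp'] pp'.
      have [|||m [[tm t t'] uniq]] := link_join Xc Xa Xt (j := k) (i := l) _ _ _ xp xp' tp tp' pp';
        rewrite ?tx //; first exact/nesym.
      exists m; split; first by split; [apply/LP; case: t|exact/asboolP|exact/asboolP].
      by move=> m' [/LP[_ ?] /asboolP ? /asboolP ?]; apply: uniq.
    - move=> p p' /LP[xp tp] /LP[xp' tp'] pp'.
      have [|||m [[tm t t'] uniq]] := link_join Xc Xa Xt (j := l) (i := k) _ _ _ xp xp' tp tp' pp';
        rewrite ?tx //; [exact/nesym|exact/nesym|].
      exists m; split.
        by split; [apply/PP; case: t|apply/asboolP/triangle_swap..].
      move=> m' [/PP[_ ?] /asboolP/triangle_swap ? /asboolP/triangle_swap ?].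
      exact: uniq.
    - move=> m /LP[xm tm]; rewrite -(pencil m P l) ?tm //; last exact/nesym.
      by congr #|` _|; apply/fsetP=> p; rewrite !inE /inc; congr (_ && _);
        apply/asboolP/asboolP => /triangle_swap.
    - by move=> p /PP[xp tp]; rewrite -(pencil p L k) ?tp //; exact/nesym.
    - move=> s p /PP[xp tp]; apply/PP; split; last by rewrite /= a_typ.
      by rewrite /= -[X in edge _ X](stabilizer_fix s); apply/act_edge.
    - move=> s p /LP[xp tp]; apply/LP; split; last by rewrite /= a_typ.
      by rewrite /= -[X in edge _ X](stabilizer_fix s); apply/act_edge.
    - move=> s p m _ _; apply/asboolP/asboolP => /=;
        by rewrite -[X in triangle _ X](stabilizer_fix s) act_triangle
          ?(stabilizer_fix s).
    - move=> m m' /LP[xm tm] /LP[xm' tm'].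
      have [g [gx gm]] := trans _ _ _ _ xm xm' tx tx tm tm'.
      have sx : in_stabilizer a x g by apply/asboolP.
      by exists (Stabilizer sx).
    - move=> s m /LP[xm tm] sm; apply/val_inj; rewrite val1.
      by apply: (free _ x m) => //; exact: stabilizer_fix.
  split=> [y y' xy xy' ty ty'|g y xy ty gx gy].
    have [s sE] := tr y y' ((PP _).2 (conj xy ty)) ((PP _).2 (conj xy' ty')).
    by exists (val s); split=> //; apply: stabilizer_fix.
  have sx : in_stabilizer a x g by apply/asboolP.
  have := fr (Stabilizer sx) y ((PP _).2 (conj xy ty)) gy.
  by move/(congr1 val); rewrite val1.
split=> [x y x' y' xy xy' tx tx' ty ty'|g x y xy tx ty]; last first.
  by have [_ fr] := main x tx; apply: fr.
have [|z xz tz] := vertex_edge Xc Xa Xt (x := x) (i := k); first by rewrite tx; exact/nesym.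
have [|z' xz' tz'] := vertex_edge Xc Xa Xt (x := x') (i := k); first by rewrite tx'; exact/nesym.
(* First bring [x] to [x'] by means of auxiliary neighbours of type [k]; then the stabiliser of [x']
   corrects the other end. *)
have [g [gx gz]] := trans _ _ _ _ xz xz' tx tx' tz tz'.
have [tr _] := main x' tx'.
have [||h [hx hy]] := tr (a g y) y' _ xy' _ ty';
  [by rewrite -gx; apply/act_edge|by rewrite a_typ|].
by exists (h * g); rewrite !gactM gx.
Qed.

Lemma regular_on_all_edges i k : i <> k -> regular_on_edges i k ->
  forall i' k', i' <> k' -> regular_on_edges i' k'.
Proof.
have from i0 k0 k' : i0 <> k0 -> regular_on_edges i0 k0 -> k' <> i0 -> regular_on_edges i0 k'.
  move=> ik R ki; have [-> //|kk] := pselect (k' = k0).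
  exact: regular_on_edges_third R.
move=> ik R i' k' ik'; have [ii|ii] := pselect (i' = i).
  by rewrite ii; apply: from R _ => //; rewrite -ii; exact/nesym.
apply: (from _ i) => //; last exact/nesym.
by apply: regular_on_edges_sym; apply: from R _.
Qed.

End PanelRegularity.

(** * The presentation *)

Section Presentations.
Variables (A : choiceType) (R : word A -> word A -> Prop).

Lemma pres_class_cat u v : pres_class R (u ++ v) = pres_class R u * pres_class R v.
Proof. by rewrite -[RHS]/(pres_mul _ _) pres_class_mul. Qed.

Lemma pres_class_cons x b u : pres_class R ((x, b) :: u) =
  (if b then pres_gen R x else (pres_gen R x)^-1) * pres_class R u.
Proof.
rewrite -cat1s pres_class_cat; congr (_ * _); case: b => //.
by rewrite -[RHS]/(pres_inv _) pres_class_inv.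
Qed.

Lemma pres_ind (P : presented R -> Prop) :
  P 1 -> (forall x y, P x -> P y -> P (x * y)) -> (forall x, P x -> P x^-1) ->
  (forall x, P (pres_gen R x)) -> forall x, P x.
Proof.
move=> P1 PM PV Pg x; rewrite -[x]pres_repr; elim: (repr x) => [//|[y b] u IHu].
by rewrite pres_class_cons; apply: PM => //; case: b => //; apply: PV.
Qed.

Section Lift.
Variables (G : groupType) (phi : A -> G).

Definition letter_value (z : A * bool) : G := if z.2 then phi z.1 else (phi z.1)^-1.

Definition word_value (u : word A) : G := foldr (fun z g => letter_value z * g) 1 u.

Lemma word_value_cat u v : word_value (u ++ v) = word_value u * word_value v.
Proof. by elim: u => [|z u IHu] /=; rewrite ?mul1g // IHu mulgA. Qed.

Hypothesis phiR : forall u v, R u v -> word_value u = word_value v.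

Lemma word_value_equiv u v : pres_equiv R u v -> word_value u = word_value v.
Proof.
elim=> // {u v} [u v w _ -> _ -> //|u u' v v' _ uE _ vE|x b].
  by rewrite !word_value_cat uE vE.
by case: b; rewrite /= /letter_value /= mulg1 ?mulgV ?mulVg.
Qed.

(** The universal property of the presentation. *)
Lemma pres_lift : exists f : {multiplicative presented R -> G},
  forall x, f (pres_gen R x) = phi x.
Proof.
pose f (x : presented R) := word_value (repr x).
have fE u : f (pres_class R u) = word_value u.
  exact/word_value_equiv/repr_pres_class.
have fM : {morph f : x y / x * y >-> x * y}.
  move=> x y; rewrite -[x]pres_repr -[y]pres_repr -pres_class_cat !fE.
  exact: word_value_cat.
pose fm := isMultiplicative.Build _ _ f fM.
pose F : {multiplicative presented R -> G} := HB.pack f fm.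
by exists F => x; rewrite /F /= fE /= /letter_value /= mulg1.
Qed.
End Lift.
End Presentations.

Section SingerGenerators.
Variables (S : 'I_3 -> groupType) (J : Type) (d : forall i, J -> S i).

Lemma singer_genM i (s t : S i) : singer_gen d (s * t) = singer_gen d s * singer_gen d t.
Proof.
rewrite /singer_gen /pres_gen -pres_class_cat; apply/pres_classP/pres_sym/pres_rel.
exact: singer_mul.
Qed.

Lemma singer_gen_triangle j : singer_gen d (d (inord 0) j) *
  singer_gen d (d (inord 1) j) * singer_gen d (d (inord 2) j) = 1.
Proof.
rewrite /singer_gen /pres_gen -[X in X * _]pres_class_cat -pres_class_cat.
rewrite -[RHS]/(pres_class (singer_relation d) [::]); apply/pres_classP/pres_rel.
exact: (singer_triangle d j).
Qed.
End SingerGenerators.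

Lemma ord3P (i : 'I_3) : [\/ i = inord 0, i = inord 1 | i = inord 2].
Proof.
case: i => -[|[|[|//]]] ?; [constructor 1|constructor 2|constructor 3];
  by apply/val_inj; rewrite /= inordK.
Qed.

Lemma ordS_I3 : (ordS (inord 0 : 'I_3) = inord 1) * (ordS (inord 1 : 'I_3) = inord 2)
  * (ordS (inord 2 : 'I_3) = inord 0).
Proof. by do !split; apply/val_inj; rewrite /= !inordK. Qed.

Lemma ord_pred_I3 : (ord_pred (inord 0 : 'I_3) = inord 2) *
  (ord_pred (inord 1 : 'I_3) = inord 0) * (ord_pred (inord 2 : 'I_3) = inord 1).
Proof. by do !split; apply/val_inj; rewrite /= !inordK. Qed.

Lemma neq_I3 : [/\ inord 0 <> inord 1 :> 'I_3, inord 0 <> inord 2 :> 'I_3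
  & inord 1 <> inord 2 :> 'I_3].
Proof. by split=> /(congr1 val); rewrite /= !inordK. Qed.

(** * Difference sets and lifts attached to a base chamber *)

Section ChamberAction.
Variables (V : choiceType) (X : set {fset V}) (typ : V -> 'I_3).
Variables (As : set (set {fset V})) (q : nat).
Hypotheses (Xc : simplicial_complex X) (Xa : apartment_system X As).
Hypotheses (Xt : colouring X typ).
Hypothesis Xo : forall p, panels X p -> chambers_on X p #= `I_q.+1.
Variables (G : groupType) (a : gaction G V).
Hypotheses (a_aut : acts_by_automorphisms X a).
Hypotheses (a_typ : forall g v, typ (a g v) = typ v).
Hypothesis reg : forall i k, i <> k -> regular_on_edges X typ a i k.
Variable v : 'I_3 -> V.
Hypotheses (v_typ : forall i, typ (v i) = i).
Hypotheses (v_edge : forall i k, i <> k -> edge X (v i) (v k)).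
Local Notation J := 'I_q.+1.

Lemma move_edge x y : edge X x y -> exists g, a g (v (typ x)) = x /\ a g (v (typ y)) = y.
Proof.
move=> xy; have txy := edge_typ Xt xy; have [trans _] := reg txy.
exact: trans (v_edge txy) xy _ _ _ _.
Qed.

Lemma edge_free i k g h : i <> k -> a g (v i) = a h (v i) -> a g (v k) = a h (v k) -> g = h.
Proof.
move=> ik gi gk; rewrite -[g](mulVKg h) (_ : h^-1 * g = 1) ?mulg1 //.
have [_ free] := reg ik; apply: (free _ _ _ (v_edge ik)) => //.
- by rewrite gactM gi gactK.
- by rewrite gactM gk gactK.
Qed.

(** The difference set in the link of [v i] for the point [v (ord_pred i)] and the line
    [v (ordS i)], written with elements of [G] so that the three sets can be multiplied together. *)
Definition difference i (g : G) :=
  a g (v i) = v i /\ triangle X (v i) (v (ord_pred i)) (a g (v (ordS i))).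

Definition enumerates (e : J -> G) (D : G -> Prop) :=
  [/\ forall j, D (e j), injective e, forall g, D g -> exists j, e j = g & e ord0 = 1].

Hypothesis v_tri : triangle X (v (inord 0)) (v (inord 1)) (v (inord 2)).

Lemma enumerate_pencil x y z : triangle X x y z -> exists e : J -> V,
  [/\ forall j, triangle X x y (e j), injective e,
      forall w, triangle X x y w -> exists j, e j = w & e ord0 = z].
Proof.
move=> t; have [_ xy _ _] := t; have C := edge_order Xc Xo xy.
have fin : finite_set [set w | triangle X x y w].
  by apply/finite_setP; exists q.+1.
pose N := fset_set [set w | triangle X x y w].
have NP w : w \in N <-> triangle X x y w by rewrite in_fset_set // inE.
(* Putting [z] first gives it index 0, which later yields the normalisation of the difference sets
   at 0. *)
pose s := z :: (N `\ z)%fset.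
have zN : z \in N by apply/NP.
have sz : size s = q.+1.
  by rewrite /= -(card_fset_set C) -/N (cardfsD1 z N) zN.
have us : uniq s by rewrite /= fset_uniq andbT !inE eqxx.
have sN w : (w \in s) = (w \in N).
  by rewrite in_cons in_fsetD1; case: eqVneq => // ->.
exists (fun j => nth z s j); split=> //.
- by move=> j; apply/NP; rewrite -sN mem_nth ?sz.
- by move=> j j' /eqP; rewrite nth_uniq ?sz // => /eqP/val_inj.
- move=> w /NP; rewrite -sN => ws.
  have ls : index w s < q.+1 by rewrite -sz index_mem.
  by exists (Ordinal ls); rewrite nth_index.
Qed.

(* A choice of [d_1] determines the other two: [d_0^-1] and [d_1] send [v_2] to
   the same vertex, and [d_2] is then defined by the triangle relation. *)
Lemma difference_families : exists e0 e1 e2 : J -> G,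
  [/\ enumerates e0 (difference (inord 0)), enumerates e1 (difference (inord 1)),
      enumerates e2 (difference (inord 2)) & forall j, e0 j * e1 j * e2 j = 1].
Proof.
rewrite /difference !ordS_I3 !ord_pred_I3.
set v0 := v (inord 0); set v1 := v (inord 1); set v2 := v (inord 2).
have [n01 n02 n12] := neq_I3.
have t01 : typ v0 = inord 0 by apply: v_typ.
have t11 : typ v1 = inord 1 by apply: v_typ.
have t21 : typ v2 = inord 2 by apply: v_typ.
have /triangle_perm[_ t102 _] := v_tri.
(* The chambers on the panel of [v0] and [v1] index all three difference sets at once. *)
have [z [zt zI zS z0]] := enumerate_pencil t102.
have ztyp j : typ (z j) = inord 2.
  apply/esym/(triangle_third_typ Xt (zt j)); rewrite v_typ //; exact/nesym.
have /choice[e1 e1P] : forall j, exists g, a g v1 = v1 /\ a g v2 = z j.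
  move=> j; have [_ _ e _] := zt j; have := move_edge e.
  by rewrite ztyp v_typ.
have /choice[e0 e0P] : forall j, exists g, a g^-1 v0 = v0 /\ a g^-1 v2 = z j.
  move=> j; have [_ _ _ e] := zt j; have := move_edge e.
  by rewrite ztyp v_typ => -[g ?]; exists g^-1; rewrite invgK.
(* Since [e1 j] sends [v2] to [z j] and [e0 j] sends [z j] back, the product fixes [v2]. *)
pose e2 j := (e0 j * e1 j)^-1.
have [e1v1 e1v2] : (forall j, a (e1 j) v1 = v1) /\ forall j, a (e1 j) v2 = z j.
  by split=> j; case: (e1P j).
have [e0v0 e0v2] : (forall j, a (e0 j)^-1 v0 = v0) /\ forall j, a (e0 j)^-1 v2 = z j.
  by split=> j; case: (e0P j).
have e0v0' j : a (e0 j) v0 = v0 by rewrite -{1}(e0v0 j) gactVK.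
have e0z j : a (e0 j) (z j) = v2 by rewrite -e0v2 gactVK.
have e2v0 j : a (e2 j) v0 = a (e1 j)^-1 v0 by rewrite /e2 invgM gactM e0v0.
have fixV g x : a g x = x -> a g^-1 x = x by move=> E; rewrite -{1}E gactK.
have e2v2 j : a (e2 j) v2 = v2 by apply: fixV; rewrite gactM e1v2 e0z.
have z0v2 : z ord0 = v2 by [].
have e10 : e1 ord0 = 1.
  by apply: (edge_free n12); rewrite gact1 ?e1v1 // e1v2.
have e00 : e0 ord0 = 1.
  rewrite -[e0 _]invgK -[RHS]invg1; congr (_^-1).
  by apply: (edge_free n02); rewrite gact1 ?e0v0 // e0v2.
exists e0, e1, e2; split.
- split=> //.
  + move=> j; split=> //; have /triangle_perm[_ /triangle_perm[t _ _] _] := zt j.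
    by move/(act_triangle a_aut (e0 j)): t; rewrite e0v0' e0z.
  + by move=> j j' E; apply: zI; rewrite -!e0v2 E.
  + move=> g [gv0 t]; have g'v0 := fixV _ _ gv0.
    have : triangle X v1 v0 (a g^-1 v2).
      move/(act_triangle a_aut g^-1): t; rewrite gactK g'v0.
      by case/triangle_perm.
    case/zS=> j zj; exists j; rewrite -[e0 j]invgK -[RHS]invgK; congr (_^-1).
    by apply: (edge_free n02); rewrite ?e0v0 ?g'v0 // e0v2.
- split=> //.
  + by move=> j; split=> //; rewrite e1v2.
  + by move=> j j' E; apply: zI; rewrite -!e1v2 E.
  + move=> g [gv1 /zS[j zj]]; exists j.
    by apply: (edge_free n12); rewrite ?e1v1 ?gv1 // e1v2.
- split=> //.
  + move=> j; split=> //; rewrite e2v0; apply/(act_triangle a_aut (e1 j)).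
    rewrite e1v2 e1v1 gactVK.
    by case: (triangle_perm (zt j)).
  + move=> j j' E.
    have E1 : (e1 j)^-1 = (e1 j')^-1.
      by apply: (edge_free n01); rewrite -?e2v0 ?E // !fixV.
    by apply: zI; rewrite -!e1v2 (invg_inj E1).
  + move=> g [gv2 t]; have [_ _ _ e] := t.
    (* The inverse of [k] fixes [v1] and sends [v2] into the pencil, so it is some [e1 j]; then
       [e2 j] and [g] agree on [v0] and [v2]. *)
    have [k [kv1 kv0]] := move_edge e.
    rewrite a_typ v_typ t11 -/v0 -/v1 in kv0 kv1.
    have k'v1 := fixV _ _ kv1.
    have : triangle X v1 v0 (a k^-1 v2).
      move/(act_triangle a_aut k^-1): t; rewrite -kv0 gactK k'v1.
      by case/triangle_perm=> _ _ /triangle_perm[].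
    case/zS=> j zj; have e1E : e1 j = k^-1.
      by apply: (edge_free n12); rewrite ?e1v1 ?k'v1 // e1v2.
    exists j; apply: (edge_free n02); rewrite ?e2v2 // ?gv2 //.
    by rewrite e2v0 e1E invgK.
  + by rewrite /e2 e00 e10 mulg1 invg1.
- by move=> j; rewrite /e2 mulgV.
Qed.

Section Presentation.
Let S i : groupType := stabilizer a (v i).
Variable d : forall i, J -> S i.
Hypothesis d_rel : forall j,
  val (d (inord 0) j) * val (d (inord 1) j) * val (d (inord 2) j) = 1.
Hypothesis d_onto : forall g, difference (inord 1) g -> exists j, val (d (inord 1) j) = g.

Local Notation PG := (singer_presented d).

(** Extended by 1 outside the stabiliser, so that generators can be written for elements of [G]
    without carrying membership proofs. *)
Definition gen_of i (g : G) : PG :=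
  if insub g is Some s then singer_gen d (s : S i) else 1.

Lemma gen_of_val i (s : S i) : gen_of i (val s) = singer_gen d s.
Proof. by rewrite /gen_of valK. Qed.

Lemma stabilizer_lift i g : a g (v i) = v i -> exists s : S i, val s = g.
Proof.
move=> gv; have sg : in_stabilizer a (v i) g by apply/asboolP.
by exists (Stabilizer sg).
Qed.

Lemma gen_ofM i g h : a g (v i) = v i -> a h (v i) = v i ->
  gen_of i (g * h) = gen_of i g * gen_of i h.
Proof.
move=> /stabilizer_lift[s <-] /stabilizer_lift[t <-].
by rewrite -valM !gen_of_val singer_genM.
Qed.

Lemma gen_of1 i : gen_of i 1 = 1.
Proof. by apply: (mulIg (gen_of i 1)); rewrite -gen_ofM ?gact1 // !mul1g. Qed.

Lemma gen_ofV i g : a g (v i) = v i -> gen_of i g^-1 = (gen_of i g)^-1.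
Proof.
move=> gv; apply: (mulIg (gen_of i g)); rewrite -gen_ofM //.
  by rewrite !mulVg gen_of1.
by rewrite -{1}gv gactK.
Qed.

Lemma anchor_exists : exists r : V -> G, forall x, a (r x) (v (typ x)) = x.
Proof.
have /choice[r rP] : forall x, exists g, a g (v (typ x)) = x; last by exists r.
move=> x; have [n _ _] := ord3_neq (typ x); have [y xy ty] := vertex_edge Xc Xa Xt n.
by have [g [gx _]] := move_edge xy; exists g.
Qed.

(** Adjacent transpositions of the vertices: flatness need only be checked for one ordering of each
    triangle. *)
Lemma cocycle_perm (H : groupType) (k : V -> V -> H) x y z :
  k y x = (k x y)^-1 -> k z y = (k y z)^-1 -> k x y * k y z = k x z ->
  k y x * k x z = k y z /\ k x z * k z y = k x y.
Proof.
by move=> yx zy <-; rewrite yx zy mulKg mulgK.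
Qed.

(* Over each vertex [x] the presented group has a torsor of lifts of [r x]; [k]
   compares the lifts over two adjacent vertices, and it is flat because of the
   triangle relations. *)
Lemma lifting_section : exists sigma : G -> PG,
  forall i (s : S i) g, sigma (g * val s) = sigma g * singer_gen d s.
Proof.
have [r rP] := anchor_exists.
(* On an edge this is the unique group element moving the corresponding base edge there; the value 1
   elsewhere is a default. *)
have /choice[lam2 lam2P] : forall xy : V * V, exists g, edge X xy.1 xy.2 ->
    a g (v (typ xy.1)) = xy.1 /\ a g (v (typ xy.2)) = xy.2.
  move=> [x y] /=; have [/move_edge[g ?]|n] := pselect (edge X x y); first by exists g.
  by exists 1 => /n.
pose lam x y := lam2 (x, y).
have lamP x y : edge X x y -> a (lam x y) (v (typ x)) = x /\ a (lam x y) (v (typ y)) = y.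
  exact: (lam2P (x, y)).
have lamE x y g : edge X x y -> a g (v (typ x)) = x -> a g (v (typ y)) = y -> lam x y = g.
  move=> xy gx gy; have [lx ly] := lamP _ _ xy.
  by apply: (edge_free (edge_typ Xt xy)); rewrite ?lx ?ly ?gx ?gy.
(* For [g] moving the base vertex to [x], this is the coordinate of [g] relative to the anchor
   [r x]. *)
pose c x g : PG := gen_of (typ x) ((r x)^-1 * g).
have cM x g h : a g (v (typ x)) = x -> a h (v (typ x)) = v (typ x) ->
    c x (g * h) = c x g * gen_of (typ x) h.
  move=> gx hx; rewrite /c mulgA gen_ofM //.
  by rewrite gactM gx -[X in a _ X = _](rP x) gactK.
pose k x y := c x (lam x y) * (c y (lam x y))^-1.
have kV x y : edge X x y -> k y x = (k x y)^-1.
  move=> xy; have [lx ly] := lamP _ _ xy; rewrite /k (lamE y x (lam x y)) //.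
    by rewrite invgM invgK.
  exact: edge_sym.
(* Put [g = lam x y] and let [h], [u0], [u2] be the differences of one index [j] at the vertices of
   type 1, 0, 2. Then [lam y z] is [g * h] and [lam x z] is [g * u0^-1], which equals [g * h * u2],
   so flatness becomes the triangle relation for [j]. *)
have flat012 x y z : triangle X x y z -> typ x = inord 0 -> typ y = inord 1 ->
    typ z = inord 2 -> k x y * k y z = k x z.
  move=> t tx ty tz; have [_ xy xz yz] := t.
  have [gx gy] := lamP _ _ xy; set g := lam x y in gx gy *.
  rewrite tx in gx; rewrite ty in gy.
  have gz : typ (a g^-1 z) = inord 2 by rewrite a_typ.
  have tg : triangle X (v (inord 1)) (v (inord 0)) (a g^-1 z).
    apply/(act_triangle a_aut g); rewrite gx gy gactVK.
    by case: (triangle_perm t).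
  have [h [hv1 hv2]] : exists h, a h (v (inord 1)) = v (inord 1) /\ a h (v (inord 2)) = a g^-1 z.
    by have [_ _ e _] := tg; have := move_edge e; rewrite gz v_typ.
  have [|j jE] := d_onto (g := h); first by split; rewrite // ordS_I3 ord_pred_I3 hv2.
  have := d_rel j; have := singer_gen_triangle d j; rewrite jE.
  rewrite -!gen_of_val jE.
  have := stabilizer_fix (d (inord 0) j); have := stabilizer_fix (d (inord 2) j).
  set u0 := val (d (inord 0) j); set u2 := val (d (inord 2) j) => u2v u0v genE uE.
  have u0E : u0^-1 = h * u2.
    by apply: (mulgI u0); rewrite mulgV mulgA uE.
  have lyz : lam y z = g * h.
    by apply: lamE; rewrite // ?ty ?tz gactM ?hv1 ?hv2 ?gactVK.
  have lxz : lam x z = g * u0^-1.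
    apply: lamE; rewrite // ?tx ?tz gactM.
      by rewrite -{1}u0v gactK.
    by rewrite u0E gactM u2v hv2 gactVK.
  have u0v' : a u0^-1 (v (inord 0)) = v (inord 0) by rewrite -{1}u0v gactK.
  rewrite /k lyz lxz -/g (cM y) ?ty // (cM x) ?tx // u0E [g * (h * u2)]mulgA.
  rewrite (cM z (g * h) u2) ?tz ?gactM ?hv2 ?gactVK // -u0E gen_ofV //.
  rewrite !invgM !mulgA mulgVK; congr (_ * _).
  rewrite -!mulgA; congr (_ * _).
  apply: (mulgI (gen_of (inord 0) u0)); apply: (mulIg (gen_of (inord 2) u2)).
  by rewrite genE !mulgA mulgV mul1g mulVg.
have swap12 x y z : triangle X x y z -> k x y * k y z = k x z -> k y x * k x z = k y z.
  by move=> [_ xy _ yz] e; have [] := cocycle_perm (kV _ _ xy) (kV _ _ yz) e.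
have swap23 x y z : triangle X x y z -> k x y * k y z = k x z -> k x z * k z y = k x y.
  by move=> [_ xy _ yz] e; have [] := cocycle_perm (kV _ _ xy) (kV _ _ yz) e.
have flat x y z : edge X x y -> edge X y z -> edge X x z ->
    X [fset x; y; z]%fset -> k x y * k y z = k x z.
  move=> xy yz xz Xxyz; have t : triangle X x y z by [].
  have txy := edge_typ Xt xy; have txz := edge_typ Xt xz; have tyz := edge_typ Xt yz.
  have [xzy yxz zxy] := triangle_perm t.
  have [yzx _ zyx] := triangle_perm yxz.
  move: txy txz tyz.
  case: (ord3P (typ x)) => tx; case: (ord3P (typ y)) => ty; case: (ord3P (typ z)) => tz;
    rewrite tx ty tz // => _ _ _.
  - exact: flat012.
  - by apply: swap23 => //; apply: flat012.
  - by apply: swap12 => //; apply: flat012.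
  - by apply: swap23 => //; apply: swap12 => //; apply: flat012.
  - by apply: swap12 => //; apply: swap23 => //; apply: flat012.
  - by apply: (swap12 y x z) => //; apply: swap23 => //; apply: swap12 => //; apply: flat012.
have [m mP] := flat_cocycle_trivial Xc Xa Xt (v (inord 0)) kV flat.
(* The trivialisation corrects the coordinate of [g] at each vertex of its chamber; [sigE] says that
   the result is the same at all three, so the section is equivariant under all three
   stabilisers. *)
pose sig i g := m (a g (v i)) * c (a g (v i)) g.
have sigE i i' g : sig i g = sig i' g.
  have [->//|ii'] := pselect (i = i').
  have e : edge X (a g (v i)) (a g (v i')) by apply/act_edge => //; apply: v_edge.
  rewrite /sig (mP _ _ e) /k (lamE _ _ g e) ?a_typ ?v_typ //.
  by rewrite -!mulgA mulVg mulg1.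
exists (sig (inord 0)) => i s g; rewrite !(sigE (inord 0) i) /sig.
have sv := stabilizer_fix s; rewrite gactM sv (cM _ g) ?a_typ ?v_typ //.
by rewrite gen_of_val mulgA.
Qed.

(** The section gives injectivity. Surjectivity comes from connectedness: the image contains the
    vertex stabilisers and reaches every vertex. *)
Lemma presentation : exists f : {multiplicative PG -> G},
  bijective f /\ forall i (s : S i), f (singer_gen d s) = val s.
Proof.
pose phi (x : {i : 'I_3 & S i}) : G := val (tagged x).
have phiR u w : singer_relation d u w -> word_value phi u = word_value phi w.
  case=> [i s t|j]; rewrite /= /letter_value /= /phi /= ?mulg1 ?valM //.
  by rewrite mulgA d_rel.
have [f fgen] := pres_lift phiR.
have fE i (s : S i) : f (singer_gen d s) = val s by rewrite /singer_gen fgen.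
have f1 : f 1 = 1 by apply: (mulIg (f 1)); rewrite -gmulfM !mul1g.
have fV x : f x^-1 = (f x)^-1.
  by apply: (mulIg (f x)); rewrite -gmulfM !mulVg.
have [sigma sigmaP] := lifting_section.
(* Equivariance extends from the generators to all of the presented group; at [g = 1] it recovers
   [x] from [f x]. *)
have sigmaE x : forall g, sigma (g * f x) = sigma g * x.
  elim/pres_ind: x => [g|x y IHx IHy g|x IHx g|[i s] g].
  - by rewrite f1 !mulg1.
  - by rewrite gmulfM mulgA IHy IHx mulgA.
  - by apply: (mulIg x); rewrite -IHx fV !mulgVK.
  - by rewrite fgen; apply: sigmaP.
have fI : injective f.
  by move=> x y fxy; apply: (mulgI (sigma 1)); rewrite -!sigmaE fxy.
(* Along an edge, [p] is multiplied on the right by a generator from the stabiliser of a base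
   vertex. *)
have reach x : exists p, a (f p) (v (typ x)) = x.
  move: x; apply: (edge_connected Xc Xa Xt (o := v (inord 0))) => [|x y xy [p px]].
    by exists 1; rewrite f1 gact1 v_typ.
  have e : edge X (v (typ x)) (a (f p)^-1 y).
    by apply/(act_edge a_aut (f p)); rewrite px gactVK.
  have [h [hx hy]] := move_edge e; rewrite a_typ v_typ in hx hy.
  have [s sE] := stabilizer_lift hx.
  by exists (p * singer_gen d s); rewrite gmulfM fE sE gactM hy gactVK.
have f_onto g : exists p, f p = g.
  have [p] := reach (a g (v (inord 0))); rewrite a_typ v_typ => pE.
  have [s sE] : exists s : S (inord 0), val s = (f p)^-1 * g.
    by apply: stabilizer_lift; rewrite gactM -pE gactK.
  by exists (p * singer_gen d s); rewrite gmulfM fE sE mulVKg.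
have /choice[f' f'P] := f_onto.
exists f; split=> //; exists f' => [x|g]; last exact: f'P.
exact/fI/f'P.
Qed.
End Presentation.
End ChamberAction.

(** * Choice of a base chamber and conclusion *)

Lemma card2_fset (T : choiceType) (A : {fset T}) : #|` A| = 2 ->
  exists x y, x <> y /\ A = [fset x; y]%fset.
Proof.
move=> A2; have [x xA] : exists x, x \in A by apply/fset0Pn; rewrite -cardfs_gt0 A2.
have /eqP/cardfs1P[y yE] : #|` (A `\ x)%fset| = 1%N.
  by move: A2; rewrite (cardfsD1 x) xA => -[].
exists x, y; split; last by rewrite -yE fsetD1K.
have : y \in (A `\ x)%fset by rewrite yE in_fset1.
by rewrite in_fsetD1 => /andP[/eqP/nesym].
Qed.

Theorem theorem5p6 (V : choiceType) (X : set {fset V}) (typ : V -> 'I_3)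
    (q : nat) (G : groupType) (a : gaction G V) (T : {fset 'I_3})
    (X_building : building X)
    (X_finite : locally_finite X)
    (X_order : forall p, panels X p -> chambers_on X p #= `I_q.+1)
    (typ_colouring : colouring X typ)
    (a_faithful : faithful_action a)
    (a_aut : acts_by_automorphisms X a)
    (a_typ : forall g v, typ (a g v) = typ v)
    (G_lattice : lattice X a)
    (T_card : #|` T| = 2)
    (T_regular : acts_regularly_on (set_action a) (panels_of_type X typ T)) :
  (forall T' : {fset 'I_3}, #|` T'| = 2 ->
     acts_regularly_on (set_action a) (panels_of_type X typ T')) /\
  exists v : 'I_3 -> V,
    let S i : groupType := stabilizer a (v i) in
    [/\ forall i, typ (v i) = i,
        chambers X [fset v i | i in 'I_3]%fset,
        forall i,
          plane_order (link_plane X typ (v i)) q /\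
          singer_group (link_plane X typ (v i))
            (stabilizer_action a (v i)) (stabilizer_action a (v i))
      & exists d : forall i, 'I_q.+1 -> S i,
          (forall i,
             ordered_difference_set (link_plane X typ (v i))
               (stabilizer_action a (v i)) (d i) /\ d i ord0 = 1) /\
          exists f : {multiplicative singer_presented d -> G},
            bijective f /\
            forall i (s : S i), f (singer_gen d s) = val s].

Proof.
have [Xc Xth [As Xa]] := X_building.
have reg : forall i k, i <> k -> regular_on_edges X typ a i k.
  have [i [k [ik TE]]] := card2_fset T_card.
  apply: (regular_on_all_edges Xc Xa typ_colouring X_finite X_order a_aut a_typ ik).
  by apply/(regular_on_panelsP typ_colouring a_typ ik); rewrite -TE.
split.
  move=> T' /card2_fset[i [k [ik ->]]].
  exact/(regular_on_panelsP typ_colouring a_typ ik)/reg.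
have [n01 n02 n12] := neq_I3.
(* The empty simplex lies in an apartment, which supplies a first vertex. *)
have [phi [phic _ _]] : exists phi, [/\ chart As phi, in_chart phi fset0 & in_chart phi fset0].
  by apply: (chart_cover Xa); case: Xc.
have [w wt] : exists w, typ w = inord 0.
  have [E|n] := pselect (typ (phi (0, 0)%R) = inord 0); first by exists (phi (0, 0)%R).
  by have [w _ ?] := vertex_edge Xc Xa typ_colouring (nesym n); exists w.
have [y wy yt] : exists2 y, edge X w y & typ y = inord 1.
  by apply: (vertex_edge Xc Xa typ_colouring); rewrite wt; apply/nesym.
have [z wyz] := edge_triangle Xa wy.
have zt : typ z = inord 2.
  by apply/esym/(triangle_third_typ typ_colouring wyz); rewrite ?wt ?yt; apply/nesym.
pose v (i : 'I_3) := nth w [:: w; y; z] i.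
have vE : (v (inord 0) = w) * (v (inord 1) = y) * (v (inord 2) = z).
  by rewrite /v !inordK.
have v_typ i : typ (v i) = i by case: (ord3P i) => ->; rewrite vE.
have v_tri : triangle X (v (inord 0)) (v (inord 1)) (v (inord 2)) by rewrite !vE.
have v_edge i k : i <> k -> edge X (v i) (v k).
  have [_ e01 e02 e12] := v_tri.
  by case: (ord3P i) => ->; case: (ord3P k) => -> //; move=> _; apply: edge_sym.
have v_tri_all i : triangle X (v i) (v (ord_pred i)) (v (ordS i)).
  by case: (ord3P i) => ->; rewrite ?ordS_I3 ?ord_pred_I3;
    have [t1 t2 t3] := triangle_perm v_tri; have [? ? ?] := triangle_perm t1;
    have [? ? ?] := triangle_perm t2; have [? ? ?] := triangle_perm t3.
have v_point i : points (link_plane X typ (v i)) (v (ord_pred i)).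
  by apply/link_point; rewrite !v_typ; split=> //; case: (v_tri_all i).
have v_line i : lines (link_plane X typ (v i)) (v (ordS i)).
  by apply/link_line; rewrite !v_typ; split=> //; case: (v_tri_all i).
have [e0 [e1 [e2 [d0 d1 d2 e_rel]]]] :=
  difference_families Xc typ_colouring X_order a_aut a_typ reg v_typ v_edge v_tri.
pose delta (i : 'I_3) := if i == inord 0 then e0 else if i == inord 1 then e1 else e2.
have deltaE : (delta (inord 0) = e0) * (delta (inord 1) = e1) * (delta (inord 2) = e2).
  have /eqP/negPf f10 := nesym n01; have /eqP/negPf f20 := nesym n02.
  by have /eqP/negPf f21 := nesym n12; rewrite /delta !eqxx f10 f20 f21.
have deltaP i : enumerates (delta i) (difference X a v i).
  by case: (ord3P i) => ->; rewrite deltaE.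
exists v => S.
(* The families so far take values in [G]; they are now lifted to the stabilisers. *)
have /(_ _)/cid dE i : exists di : 'I_q.+1 -> S i, forall j, val (di j) = delta i j.
  have /choice[di diE] : forall j, exists s : S i, val s = delta i j; last by exists di.
  by move=> j; apply: stabilizer_lift; case: (deltaP i) => /(_ j)[].
pose d i := sval (dE i).
have dP i j : val (d i j) = delta i j by rewrite /d; case: (dE i) => di /=.
split=> //.
- have -> : [fset v i | i in 'I_3]%fset = [fset v (inord 0); v (inord 1); v (inord 2)]%fset.
    apply/fsetP=> u; rewrite !inE; apply/imfsetP/idP => /= [[i _ ->]|].
      by case: (ord3P i) => ->; rewrite eqxx ?orbT.
    by case/orP=> [/orP[]|] /eqP->; eexists.
  have [Xv [_ /eqP e01] [_ /eqP e02] [_ /eqP e12]] := v_tri; split=> //.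
  by rewrite fsetUC cardfsU1 cardfs2 e01 !inE negb_or !(eq_sym (v (inord 2))) e02 e12.
- move=> i; split; first exact: (link_order Xc typ_colouring X_order).
  split; first exact: (link_projective Xc Xa typ_colouring Xth X_order).
  + split=> [s p /link_point[vp tp]|s l /link_line[vl tl]|s p l _ _] /=.
    * apply/link_point; rewrite a_typ; split=> //.
      by rewrite -[X in edge _ X](stabilizer_fix s); apply/act_edge.
    * apply/link_line; rewrite a_typ; split=> //.
      by rewrite -[X in edge _ X](stabilizer_fix s); apply/act_edge.
    * have [_ /(_ [fset v i; p; l]%fset)] := a_aut (val s).
      by rewrite fimage3 stabilizer_fix.
  (* Regularity on the points of the link is regularity on edges from the vertex to its neighbours
     of preceding type. *)
  + have [_ n _] := ord3_neq (typ (v i)); have [trans free] := reg _ _ (nesym n).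
    split=> [p p' /link_point[vp tp] /link_point[vp' tp']|s p /link_point[vp tp] sp].
      have [g [gv gp]] := trans _ _ _ _ vp vp' erefl erefl tp tp'.
      by have [s sE] := stabilizer_lift gv; exists s; rewrite /= sE.
    apply/val_inj; rewrite val1; apply: (free _ _ _ vp erefl tp) => //.
    exact: stabilizer_fix.
- have diffE i (s : S i) : difference_set (link_plane X typ (v i))
      (stabilizer_action a (v i)) (v (ord_pred i)) (v (ordS i)) s <->
      difference X a v i (val s).
    rewrite /difference_set /difference /=; split=> [Xs|[_ []]//].
    split; first exact: stabilizer_fix.
    have [n1 n2 n3] := ord3_neq i.
    apply: (triangle_typ Xc (typ := typ)); rewrite ?a_typ ?v_typ //; exact/nesym.
  exists d; split=> [i|].
    have [dD dI d_onto dE0] := deltaP i; split; last by apply/val_inj; rewrite dP val1.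
    exists (v (ord_pred i)), (v (ordS i)); split=> //; split.
    + by move=> j _; apply/diffE; rewrite dP.
    + by move=> j j' _ _ /(congr1 val); rewrite !dP => /dI.
    + move=> s /diffE/d_onto[j jE]; exists j => //.
      by apply/val_inj; rewrite dP.
  apply: (presentation Xc Xa typ_colouring a_aut a_typ reg v_typ v_edge).
  + by move=> j; rewrite !dP !deltaE.
  + move=> g; have [_ _ onto _] := deltaP (inord 1).
    by move=> /onto[j jE]; exists j; rewrite dP.
Qed.
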